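(* Let $g\in H^1(\mathbb R)$. Then $\widehat g\in L^1(\mathbb R)$.
   Context: $H^1(\mathbb R)=\{g\in L^2(\mathbb R)\mid \partial g\text{ exists and }\partial g\in L^2(\mathbb R)\}$ is the Sobolev space, where $\partial g$ denotes the weak derivative of $g$. $\widehat g$ denotes the Fourier transform of $g$ with the convention $\widehat g(u)=\int_{\mathbb R}\mathrm e^{iux}g(x)\,\mathrm dx$ for $g\in L^1(\mathbb R)$, extended to $L^2(\mathbb R)$ in the usual (Plancherel) way. *)

(* Defs.v *)
From HB Require Import structures.
From mathcomp Require Import all_boot all_order all_algebra.
From mathcomp Require Import complex.
From mathcomp Require Import all_classical all_reals all_analysis.

Set Implicit Arguments.
Unset Strict Implicit.
Unset Printing Implicit Defensive.
Import Order.TTheory GRing.Theory Num.Theory.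
Import numFieldNormedType.Exports.

Local Open Scope classical_set_scope.
Local Open Scope ring_scope.
Local Open Scope complex_scope.

(* [lebesgue_measure] lives on the Borel sets of [R] here; every class of
   Lebesgue-measurable functions modulo a.e. equality has a Borel
   representative, and functions [R -> R[i]] below are such representatives. *)

Definition cmeasurable (R : realType) (f : R -> R[i]) : Prop :=
  measurable_fun [set: R] (fun x => complex.Re (f x)) /\
  measurable_fun [set: R] (fun x => complex.Im (f x)).

(* [Normc.normc] is the modulus with values in [R], while [`|z|] has
   values in [R[i]]. *)
Definition cLnorm (R : realType) (p : R) (f : R -> R[i]) : \bar R :=
  Lnorm (@lebesgue_measure R) p%:E (fun x => (Normc.normc (f x))%:E).

Definition in_L (R : realType) (p : R) (f : R -> R[i]) : Prop :=
  cmeasurable f /\ (cLnorm p f < +oo)%E.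

(* Meaningful for [f] in L^1 (otherwise [Rintegral] may return a junk value). *)
Definition cintegral (R : realType) (f : R -> R[i]) : R[i] :=
  (\int[@lebesgue_measure R]_(x in [set: R]) complex.Re (f x)) +i*
  (\int[@lebesgue_measure R]_(x in [set: R]) complex.Im (f x)).

Definition test_function (R : realType) (phi : R -> R) : Prop :=
  (forall (n : nat) (x : R), derivable (derive1n n phi) x 1) /\
  (exists M : R, forall x : R, M < `|x| -> phi x = 0).

(* Real-valued test functions suffice, by linearity.  Only meaningful for
   locally integrable [g] and [w]; [in_H1] requires both to be in L^2. *)
Definition weak_derivative (R : realType) (g w : R -> R[i]) : Prop :=
  forall phi : R -> R, test_function phi ->
    cintegral (fun x => g x * (derive1 phi x)%:C) =
    - cintegral (fun x => w x * (phi x)%:C).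

Definition in_H1 (R : realType) (g : R -> R[i]) : Prop :=
  in_L 2 g /\ exists w : R -> R[i], weak_derivative g w /\ in_L 2 w.

Definition cexpi (R : realType) (t : R) : R[i] := cos t +i* sin t.

Definition fourier_L1 (R : realType) (f : R -> R[i]) : R -> R[i] :=
  fun u => cintegral (fun x => cexpi (u * x) * f x).

(* [fourier_L2 g h]: the square-integrable function [h] is a representative of
   the Fourier transform of [g] in L^2, i.e. [(g, h)] is in the closure, in
   L^2 x L^2, of the graph of the Fourier integral on L^1 `&` L^2.  By
   Plancherel, this is the graph of the continuous extension to L^2. *)
Definition fourier_L2 (R : realType) (g h : R -> R[i]) : Prop :=
  in_L 2 h /\
  exists f : nat -> R -> R[i],
    [/\ forall n, in_L 1 (f n) /\ in_L 2 (f n),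
        (fun n => cLnorm 2 (fun x => f n x - g x)) @ \oo --> 0%E &
        (fun n => cLnorm 2 (fun u => fourier_L1 (f n) u - h u)) @ \oo --> 0%E].

(* Main.v *)
Require Import Defs.
From mathcomp Require Import all_boot all_order all_algebra.
From mathcomp Require Import complex.
From mathcomp Require Import all_classical all_reals all_analysis.
From mathcomp Require Import ring lra.
From mathcomp Require Import measurable_realfun.

(** Parseval with constants: for [f] in L^1 and a weight [w] with integrable
    cosine transform [K], Fubini turns the integral of [w |f^|^2] into the
    double integral of [f(x) f(y) K(y - x)], which Schur's test bounds by
    [||K||_1 ||f||_2^2].  For [w(u) = (1 - (u/a)^2)^+] the kernel is bounded by
    [10 a / (1 + (a z)^2)], of integral [10 pi] whatever [a] is, hence
    [||f^||_2^2 <= C ||f||_2^2].  Existence of the transform on L^2 follows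
    from this bound and completeness.

    If [w] is the weak derivative of [g], testing against smooth plateaus and
    passing to the limit at Lebesgue points gives
    [||g(. + t) - g||_2 <= 2 t ||w||_2].  On the Fourier side the difference is
    multiplication by [exp(- i u t) - 1], so with [h = g^] the bound above yields
    [||(exp(- i u t) - 1) h||_2 <= C' t ||w||_2]; taking [t = 1/n] on [[-n, n]]
    and letting [n] grow shows that [u h(u)] is square-integrable.  By AM-GM,
    [|h| <= (1 + u^2) |h|^2 + 1 / (1 + u^2)], so [h] is integrable. *)

(** The obstacle is that neither [g] nor its weak derivative [w] need be integrable, so their
    transforms exist only as L^2 limits, while an exponential has no compact support and cannot
    serve as a test function. The formula relating the transforms of [g] and [w] is therefore never
    stated. A bound on differences of [g] replaces it: it is a pure L^2 inequality, and it survives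
    the passage to approximants in L^1.

    Every use of Parseval here either lets a norm tend to 0 or shows one to be finite. An inequality
    with some constant is enough, which is why Schur's test can do the work of an inversion formula.

    The weight has to vanish at the ends of its support. The sharp cutoff on [[- a, a]] has kernel
    [2 sin (a z) / z], which is not absolutely integrable; the parabola gains one power of decay and
    keeps an elementary closed form.

    Estimates are made on real functions, with cosine and sine transforms, and on squared norms; the
    constants grow by factors 2 when these are recombined. *)

Set Implicit Arguments.
Unset Strict Implicit.
Unset Printing Implicit Defensive.
Import Order.TTheory GRing.Theory Num.Theory.
Import numFieldNormedType.Exports.

Local Open Scope classical_set_scope.
Local Open Scope ring_scope.
Local Open Scope complex_scope.

(** * Translation invariance and the parabolic kernel *)

Section translation.
Context {R : realType}.
Local Notation mu := (@lebesgue_measure R).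

Lemma measurable_addr (t : R) : measurable_fun [set: R] (fun x : R => x + t).
Proof. exact: measurable_funD. Qed.

Lemma lebesgue_measure_addr (t : R) (A : set R) : measurable A ->
  pushforward mu (fun x : R => x + t : measurableTypeR R) A = mu A.
Proof.
move=> mA; apply/esym; apply: lebesgue_measure_unique => //=.
  exact: measurable_addr.
move=> _ _ [[a b]] _ <-; rewrite /pushforward.
have -> : (fun x : R => x + t) @^-1` `]a, b] = `]a - t, b - t]%classic.
  by apply/seteqP; split => x /=; rewrite !in_itv/= ltrBlDr lerBrDr.
by rewrite !lebesgue_measure_itv/= !lte_fin ltrD2r !EFinN -!EFinB opprB addrA subrK.
Qed.

Lemma ge0_integral_addr (t : R) (f : R -> \bar R) :
  measurable_fun [set: R] f -> (forall x, (0 <= f x)%E) ->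
  (\int[mu]_x f (x + t)%R = \int[mu]_x f x)%E.
Proof.
move=> mf f0.
have := @ge0_integral_pushforward _ _ (measurableTypeR R) (measurableTypeR R) R
  (fun x : R => x + t) (measurable_addr t) mu setT f measurableT mf (fun y _ => f0 y).
rewrite preimage_setT => <-; apply: eq_measure_integral => [|m A mA _]; first exact: measurable_addr.
exact: lebesgue_measure_addr.
Qed.

Lemma integrable_addr (t : R) (f : R -> R) :
  mu.-integrable setT (EFin \o f) ->
  mu.-integrable setT (EFin \o (fun x => f (x + t))).
Proof.
move=> /integrableP[mf foo]; apply/integrableP; split.
  by apply: (measurableT_comp mf); exact: measurable_addr.
have /= -> := @ge0_integral_addr t (fun x => `|(f x)%:E|%E) => //.
by apply/measurable_EFinP; apply: measurableT_comp => //; exact/measurable_EFinP.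
Qed.

Lemma Rintegral_addr (t : R) (f : R -> R) :
  mu.-integrable setT (EFin \o f) ->
  \int[mu]_x f (x + t) = \int[mu]_x f x.
Proof.
move=> fi; have [mf foo] := integrableP _ _ _ fi.
congr fine.
rewrite [LHS]integralE [RHS]integralE.
congr (_ - _)%E.
  have m : measurable_fun [set: R] ((fun x => (f x)%:E)^\+)%E.
    by apply: measurable_funepos; exact: mf.
  rewrite -(ge0_integral_addr t m) => [|x]; last exact: funepos_ge0.
  by apply: eq_integral => x _; rewrite !funeposE.
have m : measurable_fun [set: R] ((fun x => (f x)%:E)^\-)%E.
  by apply: measurable_funeneg; exact: mf.
rewrite -(ge0_integral_addr t m) => [|x]; last exact: funeneg_ge0.
by apply: eq_integral => x _; rewrite !funenegE.
Qed.

End translation.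

(** * The parabolic kernel and its integrable majorant *)

Section kernel.
Context {R : realType}.
Local Notation mu := (@lebesgue_measure R).

(** Derivative of [atan (a * z)] in [z]: a dilated Cauchy density, up to the factor pi. *)
Definition cauchy_kernel (a z : R) : R := a / (1 + (a * z) ^+ 2).

Lemma cauchy_kernel_den_gt0 (a z : R) : 0 < 1 + (a * z) ^+ 2.
Proof. by rewrite ltr_pwDl// sqr_ge0. Qed.

Lemma cauchy_kernel_ge0 (a z : R) : 0 <= a -> 0 <= cauchy_kernel a z.
Proof. by move=> a0; rewrite divr_ge0// ltW// cauchy_kernel_den_gt0. Qed.

Lemma cauchy_kernelN (a z : R) : cauchy_kernel a (- z) = cauchy_kernel a z.
Proof. by rewrite /cauchy_kernel mulrN sqrrN. Qed.

Lemma continuous_cauchy_kernel (a : R) : continuous (cauchy_kernel a).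
Proof.
move=> z; apply: cvgM; first exact: cvg_cst.
apply: cvgV; first by rewrite gt_eqF// cauchy_kernel_den_gt0.
apply: cvgD; first exact: cvg_cst.
by apply: cvgM; apply: cvgM => //; exact: cvg_cst.
Qed.

Lemma integral_cauchy_kernel (a : R) : 0 < a ->
  (\int[mu]_z (cauchy_kernel a z)%:E = pi%:E)%E.
Proof.
move=> a0.
have mk : measurable_fun setT (EFin \o cauchy_kernel a).
  apply/measurable_EFinP. apply: continuous_measurable_fun. exact: continuous_cauchy_kernel.
have k0 z : (0 <= (cauchy_kernel a z)%:E)%E.
  by rewrite lee_fin cauchy_kernel_ge0// ltW.
have half : (\int[mu]_(z in `[0%R, +oo[) (cauchy_kernel a z)%:E = (pi / 2)%:E)%E.
  rewrite (@ge0_continuous_FTC2y _ _ (fun z => atan (a * z)) _ (pi / 2)).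
  - by rewrite mulr0 atan0 sube0.
  - by move=> x _; rewrite cauchy_kernel_ge0// ltW.
  - by apply: continuous_subspaceT; exact: continuous_cauchy_kernel.
  - apply: (@cvg_comp _ _ _ (fun z => a * z) atan _ (pinfty_nbhs R)).
      exact: gt0_cvgMry.
    exact: cvgy_atan.
  - by move=> x _; apply: ex_derive.
  - apply: cvg_at_right_filter.
    apply: (@continuous_comp _ _ _ (fun z => a * z) atan).
      by apply: cvgM => //; exact: cvg_cst.
    exact: continuous_atan.
  - move=> x _; rewrite derive1E.
    have dF : is_derive x (1 : R) (fun z => atan (a * z)) (cauchy_kernel a x).
      apply: is_derive_eq; rewrite /GRing.scale/= /cauchy_kernel; field.
      by rewrite gt_eqF// cauchy_kernel_den_gt0.
    exact: derive_val.
have half' : (\int[mu]_(z in `]-oo, 0%R]) (cauchy_kernel a z)%:E = (pi / 2)%:E)%E.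
  rewrite -half ge0_integration_by_substitution0//.
  by apply: eq_integral => z _; rewrite cauchy_kernelN.
have -> : [set: R] = `]-oo, 0%R] `|` `]0%R, +oo[.
  by apply/seteqP; split=> x //= _; rewrite !in_itv/= andbT; apply/orP; case: leP.
rewrite ge0_integral_setU//=; last 2 first.
- exact: measurable_funTS.
- rewrite disj_set2E; apply/eqP/seteqP; split => x //=.
  by rewrite !in_itv/= andbT => -[x0 /(le_lt_trans x0)]; rewrite ltxx.
rewrite half' integral_itv_obnd_cbnd ?half; last exact: measurable_funTS.
by rewrite -EFinD -splitr.
Qed.

(** The Fourier transform of the parabolic weight; since the weight is even, only the cosine part is
    written. *)
Definition parabolic_kernel (a z : R) : R :=
  \int[mu]_(u in `[- a, a]) ((1 - (u / a) ^+ 2) * cos (u * z)).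

Lemma parabolic_kernelE (a z : R) : 0 < a -> z != 0 ->
  parabolic_kernel a z = 4 * (sin (a * z) - a * z * cos (a * z)) / (a ^+ 2 * z ^+ 3).
Proof.
move=> a0 z0; have an0 : a != 0 by rewrite gt_eqF.
(* Primitive obtained by integrating by parts twice. Its first term vanishes at [- a] and [a], which
   removes the slow decay in [1 / z]. *)
pose F (u : R) := (1 - (u / a) ^+ 2) * sin (u * z) / z
  - 2 * u * cos (u * z) / (a ^+ 2 * z ^+ 2) + 2 * sin (u * z) / (a ^+ 2 * z ^+ 3).
have dF u : is_derive u (1 : R) F ((1 - (u / a) ^+ 2) * cos (u * z)).
  rewrite /F; apply: is_derive_eq; rewrite /GRing.scale/=.
  field.
  by rewrite an0 z0.
have cF : continuous F.
  by move=> u; apply: differentiable_continuous; apply/derivable1_diffP; exact: ex_derive.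
rewrite /parabolic_kernel /Rintegral (@continuous_FTC2 _ _ F).
- rewrite -EFinB /= /F.
  rewrite !mulNr sinN cosN sqrrN divff// expr1n subrr !mul0r.
  by field; rewrite an0 z0.
- by rewrite gtrN.
- apply: continuous_subspaceT => u; apply: differentiable_continuous.
  by apply/derivable1_diffP; exact: ex_derive.
- split; first by move=> u _; exact: ex_derive.
    by apply: cvg_at_right_filter; exact: cF.
  by apply: cvg_at_left_filter; exact: cF.
- by move=> u _; rewrite derive1E; exact: derive_val.
Qed.

(** The constant is 10 = 2 + 8. The integrand is at most 1 in modulus, so the kernel is at most
    [2 * a]; this suffices when [|a * z| <= 1]. Otherwise the numerator of the closed form is at
    most [1 + |a * z| <= 2 * |a * z|], and the kernel times [(a * z) ^+ 2] is at most [8 * a]. *)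
Lemma le_parabolic_kernel (a z : R) : 0 < a ->
  `|parabolic_kernel a z| <= 10 * cauchy_kernel a z.
Proof.
move=> a0.
have Kle : `|parabolic_kernel a z| <= 2 * a.
  have mf : measurable_fun `[- a, a] (fun u : R => (1 - (u / a) ^+ 2) * cos (u * z)).
    apply: measurable_funTS; apply: measurable_funM.
      by apply: measurable_funB => //; apply: measurable_funX; exact: measurable_funM.
    by apply: (measurableT_comp (continuous_measurable_fun (@continuous_cos R))); exact: measurable_funM.
  have le1 u : `[- a, a]%classic u -> `|(1 - (u / a) ^+ 2) * cos (u * z)| <= 1.
    rewrite /= in_itv/= -ler_norml => ua.
    rewrite normrM mulr_ile1// ?cos_max//.
    have : 0 <= (u / a) ^+ 2 <= 1.
      rewrite sqr_ge0 -real_normK ?num_real// expr_le1// normrM normfV (gtr0_norm a0).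
      by rewrite ler_pdivrMr// mul1r.
    by rewrite ler_norml => /andP[h0 h1]; apply/andP; split; lra.
  have ma : (mu `[(- a)%R, a]%classic < +oo)%E by rewrite lebesgue_measure_itv/=; case: ifP; rewrite ?ltry.
  have if1 : mu.-integrable `[- a, a] (EFin \o (fun u : R => (1 - (u / a) ^+ 2) * cos (u * z))).
    apply: measurable_bounded_integrable => //.
    exists 1; split; first by rewrite num_real.
    by move=> M M1 u ua; apply: (le_trans (le1 _ ua)); exact: ltW.
  have if2 : mu.-integrable `[- a, a] (EFin \o (cst 1 : R -> R)).
    apply: measurable_bounded_integrable => //.
    exists 1; split; first by rewrite num_real.
    by move=> M M1 u ua /=; rewrite normr1 ltW.
  apply: (le_trans (le_normr_Rintegral _ if1)) => //.
  apply: (@le_trans _ _ (\int[mu]_(u in `[- a, a]) (cst 1 u))).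
    by apply: le_Rintegral => //; exact: integrable_norm.
  rewrite Rintegral_cst//= lebesgue_measure_itv/= lte_fin gtrN// -EFinB/=.
  by rewrite mul1r opprK -mulr2n mulr_natl.
rewrite /cauchy_kernel mulrA ler_pdivlMr ?cauchy_kernel_den_gt0// mulrDr mulr1.
have [az1|az1] := leP (`|a * z|) 1.
  have : (a * z) ^+ 2 <= 1 by rewrite -real_normK ?num_real// expr_le1.
  have := normr_ge0 (parabolic_kernel a z); set p := `|parabolic_kernel a z| in Kle *; nra.
have z0 : z != 0.
  by apply: contraTneq az1 => ->; rewrite mulr0 normr0 -leNgt.
have : `|parabolic_kernel a z| * (a * z) ^+ 2 <= 8 * a; last by lra.
rewrite -(real_normK (num_real (a * z))) parabolic_kernelE//.
have an0 : a != 0 by rewrite gt_eqF.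
set s := sin _; set c := cos _.
have num : `|s - a * z * c| <= 2 * `|a * z|.
  rewrite (le_trans (ler_normB _ _))// normrM.
  have : `|s| <= 1 by exact: sin_max.
  have : `|c| <= 1 by exact: cos_max.
  set w := `|a * z|  in az1 *; have := normr_ge0 c; have := normr_ge0 s; nra.
have -> : a ^+ 2 * z ^+ 3 = (a * z) ^+ 3 / a by field.
have nz : `|a * z| = a * `|z| by rewrite normrM gtr0_norm.
rewrite nz in az1 num *.
rewrite !(normrM, normrX, normfV) (gtr0_norm a0) (@ger0_norm _ 4)//.
set w := `|z| in az1 num *; have w0 : 0 < a * w by lra.
set p := `|_ - _| in num *.
have -> : 4 * p / ((a * w) ^+ 3 / a) * (a * w) ^+ 2 = 4 * a * (p / (a * w)).
  by field; rewrite /w normr_eq0 ?an0 ?z0.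
have : p / (a * w) <= 2 by rewrite ler_pdivrMr.
by move=> h; nra.
Qed.

End kernel.

(** * Fubini and Schur test *)

Section integrability.
Context {R : realType}.
Local Notation mu := (@lebesgue_measure R).
Local Notation L1 f := (mu.-integrable [set: R] (EFin \o f)).

Lemma integrableRP (f : R -> R) : L1 f <->
  measurable_fun [set: R] f /\ (\int[mu]_x `|f x|%:E < +oo)%E.
Proof.
split=> [/integrableP[/measurable_EFinP mf foo]//|[mf foo]].
by apply/integrableP; split; [exact/measurable_EFinP|].
Qed.

Lemma integrableRD (f g : R -> R) : L1 f -> L1 g -> L1 (fun x => f x + g x).
Proof. by move=> fi gi; rewrite (_ : EFin \o _ = (EFin \o f) \+ (EFin \o g))%E//; exact: integrableD. Qed.

Lemma integrableRB (f g : R -> R) : L1 f -> L1 g -> L1 (fun x => f x - g x).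
Proof. by move=> fi gi; rewrite (_ : EFin \o _ = (EFin \o f) \- (EFin \o g))%E//; exact: integrableB. Qed.

Lemma integrable_boundedM (M : R) (k f : R -> R) : measurable_fun [set: R] k ->
  (forall x, `|k x| <= M) -> L1 f -> L1 (fun x => k x * f x).
Proof.
move=> mk kM fi; rewrite (_ : EFin \o _ = (EFin \o k) \* (EFin \o f))%E//.
apply: integrableMr => //.
exists M; split; first by rewrite num_real.
by move=> N MN x _; apply: (le_trans (kM x)); exact: ltW.
Qed.

(** The double integrand is dominated by [|f x| * |g y|], integrable on the plane. The intended [k]
    is an oscillating factor [e (x * y)]. *)
Lemma fubini_boundedM (f g : R -> R) (k : R * R -> R) :
  L1 f -> L1 g -> measurable_fun [set: R * R] k -> (forall p, `|k p| <= 1) ->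
  \int[mu]_x (f x * \int[mu]_y (k (x, y) * g y)) =
  \int[mu]_y (g y * \int[mu]_x (k (x, y) * f x)).
Proof.
move=> fi gi mk k1.
have [mf foo] := (integrableRP f).1 fi; have [mg goo] := (integrableRP g).1 gi.
pose F (p : R * R) := f p.1 * k p * g p.2.
have mF : measurable_fun [set: R * R] F.
  apply: measurable_funM; last exact: (measurableT_comp mg).
  by apply: measurable_funM => //; exact: (measurableT_comp mf).
have iF : (mu \x mu)%E.-integrable [set: R * R] (EFin \o F).
  apply/integrable12ltyP; first exact/measurable_EFinP.
  apply: (@le_lt_trans _ _ (\int[mu]_x (`|f x|%:E * \int[mu]_y `|g y|%:E))%E).
    apply: ge0_le_integral => //.
    - by move=> x _; exact: integral_ge0.
    - have := @measurable_fun_fubini_tonelli_F _ _ _ _ _ mu (fun p : R * R => `|F p|%:E).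
      apply=> //; apply/measurable_EFinP; exact: measurableT_comp.
    - by apply: emeasurable_funM => //; apply/measurable_EFinP; exact: measurableT_comp.
    - move=> x _; rewrite -ge0_integralZl//=; last first.
        by apply/measurable_EFinP; exact: measurableT_comp.
      apply: ge0_le_integral => //=.
      + by apply/measurable_EFinP; do 2 apply: measurableT_comp => //.
      + by apply: emeasurable_funM => //; apply/measurable_EFinP; exact: measurableT_comp.
      + move=> y _; rewrite -EFinM lee_fin /F/= !normrM ler_wpM2r// ler_piMr//.
  rewrite ge0_integralZr//; last 2 first.
    by apply/measurable_EFinP; exact: measurableT_comp.
    exact: integral_ge0.
  by apply: lte_mul_pinfty => //; [exact: integral_ge0|rewrite ge0_fin_numE//; exact: integral_ge0].
have kx x : measurable_fun [set: R] (fun y => k (x, y)).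
  by apply: (measurableT_comp mk); exact: measurable_pair1.
have ky y : measurable_fun [set: R] (fun x => k (x, y)).
  by apply: (measurableT_comp mk); exact: measurable_pair2.
rewrite /Rintegral; congr fine.
transitivity (\int[mu]_x \int[mu]_y (EFin \o F) (x, y))%E.
  apply: eq_integral => x _.
  have kgi : L1 (fun y => k (x, y) * g y) by exact: (@integrable_boundedM 1).
  rewrite EFinM fineK; last exact: integrable_fin_num.
  rewrite -integralZl//; apply: eq_integral => y _.
  by rewrite /F/= -EFinM mulrA.
rewrite Fubini//; apply: eq_integral => y _.
have kfi : L1 (fun x => k (x, y) * f x) by exact: (@integrable_boundedM 1).
rewrite EFinM fineK; last exact: integrable_fin_num.
rewrite -integralZl//; apply: eq_integral => x _.
by rewrite /F/= -EFinM; congr EFin; ring.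
Qed.

(** Monotone convergence. It removes the cutoffs: both the weighted Parseval bound and the moment
    bound are proved on [[- n, n]] with a constant independent of [n]. *)
Lemma ge0_integral_le_itv (F : R -> \bar R) (c : \bar R) :
  measurable_fun [set: R] F -> (forall x, (0 <= F x)%E) ->
  (forall n : nat, (\int[mu]_(x in `[(- n%:R)%R, n%:R%R]) F x <= c)%E) ->
  (\int[mu]_x F x <= c)%E.
Proof.
move=> mF F0 Fc.
pose G (n : nat) := F \_ `[- n%:R, n%:R].
have mG n : measurable_fun [set: R] (G n).
  by apply/(measurable_restrictT _ _).1 => //; exact: measurable_funTS.
have G0 n x : [set: R] x -> (0 <= G n x)%E.
  by move=> _; rewrite /G patchE; case: ifP.
have ndG x : [set: R] x -> {homo G ^~ x : n m / (n <= m)%N >-> (n <= m)%E}.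
  move=> _ n m nm; rewrite /G !patchE; case: ifPn => // xn; last by case: ifP.
  rewrite ifT//; move: xn; rewrite !inE/= !in_itv/= => /andP[x1 x2].
  have : n%:R <= m%:R :> R by rewrite ler_nat.
  by move=> nm'; apply/andP; split; lra.
have -> : (\int[mu]_x F x = \int[mu]_x limn (G ^~ x))%E.
  apply: eq_integral => x _; apply/esym/cvg_lim => //.
  apply: cvg_near_cst; near=> n.
  rewrite /G patchE ifT// inE/= in_itv/= -ler_norml.
  by near: n; exact: nbhs_infty_ger.
rewrite monotone_convergence//.
apply: lime_le.
  apply: ereal_nondecreasing_is_cvgn => n m nm; apply: ge0_le_integral => //.
  - exact: G0.
  - exact: mG.
  - exact: mG.
  - by move=> x _; exact: ndG.
by near=> n; rewrite /G -integral_mkcond.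
Unshelve. all: by end_near. Qed.

(* [|f(x) f(y)| <= (f(x)^2 + f(y)^2) / 2], and evenness of [k] makes both halves equal. *)
Lemma schur_even (k f : R -> R) (c : \bar R) :
  measurable_fun [set: R] k -> (forall x, 0 <= k x) -> (forall x, k (- x) = k x) ->
  (\int[mu]_x (k x)%:E = c)%E -> measurable_fun [set: R] f ->
  (\int[mu]_x \int[mu]_y (`|f x| * (`|f y| * k (y - x)))%:E
   <= c * \int[mu]_x (f x ^+ 2)%:E)%E.
Proof.
move=> mk k0 kN kc mf.
have mkd : measurable_fun [set: R * R] (fun p : R * R => k (p.2 - p.1)).
  by apply: (measurableT_comp mk); apply: measurable_funB.
have c0 : (0 <= c)%E by rewrite -kc; apply: integral_ge0 => x _; rewrite lee_fin.
have kx x : (\int[mu]_y (k (y - x))%:E = c)%E.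
  rewrite (@ge0_integral_addr _ (- x) (EFin \o k)) ?kc//.
  exact/measurable_EFinP.
have mf2 : measurable_fun [set: R] (fun x => (f x ^+ 2)%:E).
  by apply/measurable_EFinP; exact: measurable_funX.
pose G (p : R * R) : \bar R := (f p.1 ^+ 2 * k (p.2 - p.1))%:E.
pose H (p : R * R) : \bar R := (f p.2 ^+ 2 * k (p.2 - p.1))%:E.
have mG : measurable_fun [set: R * R] G.
  apply/measurable_EFinP; apply: measurable_funM => //.
  by apply: measurable_funX; exact: (measurableT_comp mf).
have mH : measurable_fun [set: R * R] H.
  apply/measurable_EFinP; apply: measurable_funM => //.
  by apply: measurable_funX; exact: (measurableT_comp mf).
have G0 p : (0 <= G p)%E by rewrite lee_fin mulr_ge0// sqr_ge0.
have H0 p : (0 <= H p)%E by rewrite lee_fin mulr_ge0// sqr_ge0.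
have mFG := @measurable_fun_fubini_tonelli_F _ _ _ _ _ mu G mG G0.
have mFH := @measurable_fun_fubini_tonelli_F _ _ _ _ _ mu H mH H0.
have mGx x : measurable_fun [set: R] (fun y => G (x, y)).
  by apply: (measurableT_comp mG); exact: measurable_pair1.
have mHx x : measurable_fun [set: R] (fun y => H (x, y)).
  by apply: (measurableT_comp mH); exact: measurable_pair1.
have intG : (\int[mu]_x \int[mu]_y G (x, y) = c * \int[mu]_x (f x ^+ 2)%:E)%E.
  rewrite -ge0_integralZl//; last by move=> x _; rewrite lee_fin sqr_ge0.
  apply: eq_integral => x _; rewrite /G/=.
  under eq_integral do rewrite EFinM.
  rewrite ge0_integralZl//; last 3 first.
  - by apply/measurable_EFinP; apply: (measurableT_comp mk); exact: measurable_funB.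
  - by move=> y _; rewrite lee_fin.
  - by rewrite lee_fin sqr_ge0.
  by rewrite kx muleC.
have intH : (\int[mu]_x \int[mu]_y H (x, y) = c * \int[mu]_x (f x ^+ 2)%:E)%E.
  rewrite (@fubini_tonelli _ _ _ _ _ mu mu H)//.
  rewrite -ge0_integralZl//; last by move=> x _; rewrite lee_fin sqr_ge0.
  apply: eq_integral => y _; rewrite /H/=.
  under eq_integral do rewrite EFinM -kN opprB.
  rewrite ge0_integralZl//; last 3 first.
  - by apply/measurable_EFinP; apply: (measurableT_comp mk); exact: measurable_funB.
  - by move=> x _; rewrite lee_fin.
  - by rewrite lee_fin sqr_ge0.
  by rewrite kx muleC.
have -> : (c * \int[mu]_x (f x ^+ 2)%:E =
   2^-1%:E * (\int[mu]_x (\int[mu]_y G (x, y) + \int[mu]_y H (x, y))))%E.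
  rewrite ge0_integralD//; last 2 first.
  - by move=> x _; exact: integral_ge0.
  - by move=> x _; exact: integral_ge0.
  rewrite intG intH; have : (0 <= c * \int[mu]_x (f x ^+ 2)%:E)%E.
    by rewrite mule_ge0//; apply: integral_ge0 => x _; rewrite lee_fin sqr_ge0.
  (* The product can be [+oo], where the halving is checked separately. *)
  case: (c * _)%E => [r _||//]; last by rewrite addye// gt0_muley// lte_fin invr_gt0.
  by rewrite -EFinD -EFinM; congr EFin; field.
rewrite -ge0_integralZl//; last 2 first.
- exact: emeasurable_funD.
- by move=> x _; rewrite adde_ge0// integral_ge0.
apply: ge0_le_integral => //.
- by move=> x _; apply: integral_ge0 => y _; rewrite lee_fin !mulr_ge0.
- have := @measurable_fun_fubini_tonelli_F _ _ _ _ _ mu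
    (fun p : R * R => (`|f p.1| * (`|f p.2| * k (p.2 - p.1)))%:E); apply.
    apply/measurable_EFinP; apply: measurable_funM.
      by apply: measurableT_comp => //; exact: (measurableT_comp mf).
    apply: measurable_funM => //.
    by apply: measurableT_comp => //; exact: (measurableT_comp mf).
  by move=> p; rewrite lee_fin !mulr_ge0.
- by apply: emeasurable_funM => //; exact: emeasurable_funD.
- move=> x _.
  have mGH : measurable_fun [set: R] (fun y => G (x, y) + H (x, y))%E.
    by apply: emeasurable_funD; [exact: mGx|exact: mHx].
  have -> : (2^-1%:E * (\int[mu]_y G (x, y) + \int[mu]_y H (x, y)) =
      \int[mu]_y (2^-1%:E * (G (x, y) + H (x, y))))%E.
    rewrite ge0_integralZl//; last by move=> y _; rewrite adde_ge0.
    congr (_ * _)%E; apply/esym; apply: ge0_integralD => //.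
    - exact: mGx.
    - exact: mHx.
  apply: ge0_le_integral => //.
  + by move=> y _; rewrite lee_fin !mulr_ge0.
  + apply/measurable_EFinP; apply: measurable_funM => //.
    apply: measurable_funM; first exact: measurableT_comp.
    by apply: (measurableT_comp mk); exact: measurable_funB.
  + by apply: emeasurable_funM => //; exact: mGH.
  + move=> y _; rewrite /G /H/= -EFinD -EFinM lee_fin.
    have := k0 (y - x); set z := k _ => z0.
    rewrite -mulrDl !mulrA ler_wpM2r// -(real_normK (num_real (f x))) -(real_normK (num_real (f y))).
    have := sqr_ge0 (`|f x| - `|f y|); nra.
Qed.

End integrability.

(** * The L^2 bound for Fourier integrals *)

Section oscillatory.
Context {R : realType}.
Local Notation mu := (@lebesgue_measure R).
Local Notation L1 f := (mu.-integrable [set: R] (EFin \o f)).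

(** The cosine and sine transforms at once: the arguments below only use that [e] is continuous and
    bounded by 1. *)
Definition oscint (e f : R -> R) (u : R) : R := \int[mu]_x (e (u * x) * f x).

Section bounded_phase.
Variable e : R -> R.
Hypotheses (ce : continuous e) (e1 : forall x, `|e x| <= 1).

Let me : measurable_fun [set: R] e.
Proof. exact: continuous_measurable_fun. Qed.

Let mex u : measurable_fun [set: R] (fun x => e (u * x)).
Proof. by apply: (measurableT_comp me); exact: measurable_funM. Qed.

Lemma integrable_oscint (f : R -> R) u : L1 f -> L1 (fun x => e (u * x) * f x).
Proof. by move=> fi; exact: (@integrable_boundedM _ 1). Qed.

Lemma continuous_oscint (f : R -> R) : L1 f -> continuous (oscint e f).
Proof.
move=> fi u.
have [mf _] := (integrableRP f).1 fi.
have := @continuity_under_integral _ _ _ mu (fun u x => e (u * x) * f x) setT measurableT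
  (u - 1) (u + 1) _ _ (fun x => `|f x|) _ _ u.
apply => //.
- by move=> v _; exact: integrable_oscint.
- apply: aeW => x _ v _; apply: cvgM; last exact: cvg_cst.
  apply: (@continuous_comp _ _ _ (fun v : R => v * x) e); last exact: ce.
  by apply: cvgM => //; exact: cvg_cst.
- exact: integrable_norm.
- by move=> v _; apply: aeW => x _; rewrite normrM ler_piMl.
- by rewrite inE/= in_itv/=; apply/andP; split; lra.
Qed.

Lemma le_oscint (f : R -> R) u : L1 f -> `|oscint e f u| <= \int[mu]_x `|f x|.
Proof.
move=> fi; apply: (le_trans (le_normr_Rintegral _ (integrable_oscint u fi))) => //.
apply: le_Rintegral => //.
- exact: integrable_norm (integrable_oscint u fi).
- exact: integrable_norm.
- by move=> x _; rewrite normrM ler_piMl.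
Qed.

Lemma integrable_oscintM (w f : R -> R) : L1 w -> L1 f ->
  L1 (fun u => oscint e f u * w u).
Proof.
move=> wi fi; apply: (integrable_boundedM _ (fun u => le_oscint u fi)) => //.
by apply: continuous_measurable_fun; exact: continuous_oscint.
Qed.

(** First exchange of integrals. The weight makes [oscint e f * w] integrable, whereas [oscint e f]
    alone is merely bounded and continuous. *)
Lemma weighted_oscint_sqr (w f : R -> R) : L1 w -> L1 f ->
  \int[mu]_u (oscint e f u * w u * oscint e f u) =
  \int[mu]_x (f x * oscint e (fun u => oscint e f u * w u) x).
Proof.
move=> wi fi.
have mk : measurable_fun [set: R * R] (fun p : R * R => e (p.1 * p.2)).
  by apply: (measurableT_comp me); exact: measurable_funM.
rewrite (fubini_boundedM (k := fun p => e (p.1 * p.2)) (integrable_oscintM wi fi) fi mk (fun p => e1 _)).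
by apply: eq_Rintegral => x _; congr (_ * _); apply: eq_Rintegral => u _ /=; rewrite (mulrC u).
Qed.

(** Second exchange. The product of phases becomes a function of [y - x] only after the
    contributions of [cos] and [sin] are added. *)
Lemma oscint_oscintM (w f : R -> R) x : L1 w -> L1 f ->
  oscint e (fun u => oscint e f u * w u) x =
  \int[mu]_y (f y * \int[mu]_u (e (u * x) * e (u * y) * w u)).
Proof.
move=> wi fi.
have mk : measurable_fun [set: R * R] (fun p : R * R => e (p.1 * p.2)).
  by apply: (measurableT_comp me); exact: measurable_funM.
transitivity (\int[mu]_u (e (x * u) * w u * \int[mu]_y (e (u * y) * f y))).
  by apply: eq_Rintegral => u _; rewrite -/(oscint e f u); ring.
rewrite (fubini_boundedM (k := fun p => e (p.1 * p.2)) (integrable_oscint x wi) fi mk (fun p => e1 _)).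
apply: eq_Rintegral => y _; congr (_ * _); apply: eq_Rintegral => u _ /=.
by rewrite (mulrC u x); ring.
Qed.

End bounded_phase.

Local Notation C f := (oscint cos f).
Local Notation S f := (oscint sin f).

Definition parabolic_weight (a : R) : R -> R :=
  (fun u => 1 - (u / a) ^+ 2) \_ `[- a, a].

Lemma integrable_parabolic_weight (a : R) : L1 (parabolic_weight a).
Proof.
rewrite /parabolic_weight -restrict_EFin.
apply/(integrable_mkcond _ _).1 => //.
apply: continuous_compact_integrable; first exact: segment_compact.
apply: continuous_subspaceT => u; apply: differentiable_continuous.
by apply/derivable1_diffP; exact: ex_derive.
Qed.

(** Gives the kernel the continuity and the uniform bound of a cosine transform, hence the
    measurability and integrability used below. *)
Lemma parabolic_kernel_oscint (a : R) : parabolic_kernel a = C (parabolic_weight a).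
Proof.
apply/funext => z; rewrite /parabolic_kernel /oscint Rintegral_mkcond.
apply: eq_Rintegral => u _; rewrite /parabolic_weight !patchE; case: ifP => _.
  by rewrite mulrC (mulrC u).
by rewrite mulr0.
Qed.

Lemma plancherel_weighted (a : R) (f : R -> R) : 0 < a -> L1 f ->
  (\int[mu]_u (parabolic_weight a u * (C f u ^+ 2 + S f u ^+ 2))%:E <=
   (10 * pi)%:E * \int[mu]_x (f x ^+ 2)%:E)%E.
Proof.
move=> a0 fi; have [mf foo] := (integrableRP f).1 fi.
set w := parabolic_weight a; have wi : L1 w by exact: integrable_parabolic_weight.
have cc := @continuous_cos R; have cs := @continuous_sin R.
have c1 := @cos_max R; have s1 := @sin_max R.
pose H x := oscint cos (fun u => C f u * w u) x + oscint sin (fun u => S f u * w u) x.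
have wCi := integrable_oscintM cc c1 wi fi; have wSi := integrable_oscintM cs s1 wi fi.
have mH : measurable_fun [set: R] H.
  by apply: measurable_funD; apply: continuous_measurable_fun; exact: continuous_oscint.
have fCi : L1 (fun x => f x * oscint cos (fun u => C f u * w u) x).
  rewrite (_ : (fun x => _) = (fun x => oscint cos (fun u => C f u * w u) x * f x)).
    exact: integrable_oscintM.
  by apply/funext => x; rewrite mulrC.
have fSi : L1 (fun x => f x * oscint sin (fun u => S f u * w u) x).
  rewrite (_ : (fun x => _) = (fun x => oscint sin (fun u => S f u * w u) x * f x)).
    exact: integrable_oscintM.
  by apply/funext => x; rewrite mulrC.
have wCCi : L1 (fun u => C f u * w u * C f u).
  rewrite (_ : (fun x => _) = (fun u => C f u * (C f u * w u))).
    exact: integrable_oscintM.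
  by apply/funext => x; rewrite mulrC.
have wSSi : L1 (fun u => S f u * w u * S f u).
  rewrite (_ : (fun x => _) = (fun u => S f u * (S f u * w u))).
    exact: integrable_oscintM.
  by apply/funext => x; rewrite mulrC.
have e1 : \int[mu]_u (w u * (C f u ^+ 2 + S f u ^+ 2)) = \int[mu]_x (f x * H x).
  transitivity (\int[mu]_u (C f u * w u * C f u + S f u * w u * S f u)).
    by apply: eq_Rintegral => u _; ring.
  rewrite (RintegralD measurableT wCCi wSSi) (weighted_oscint_sqr cc c1 wi fi).
  rewrite (weighted_oscint_sqr cs s1 wi fi) -(RintegralD measurableT fCi fSi).
  by apply: eq_Rintegral => x _; rewrite /H; ring.
(* The sum of the two squares matters here: the products of cosines and of sines add up to
   [cos (u * y - u * x)], so the kernel is a convolution kernel. *)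
have HE x : H x = \int[mu]_y (f y * parabolic_kernel a (y - x)).
  have ik (e : R -> R) : continuous e -> (forall x, `|e x| <= 1) -> forall y,
      L1 (fun u => e (u * x) * e (u * y) * w u).
    move=> ce e1' y; apply: (@integrable_boundedM _ 1) => //.
      apply: measurable_funM; apply: (measurableT_comp (continuous_measurable_fun ce));
        exact: measurable_funM.
    by move=> u; rewrite normrM mulr_ile1.
  have oi (e : R -> R) : continuous e -> (forall x, `|e x| <= 1) ->
      L1 (fun y => f y * \int[mu]_u (e (u * x) * e (u * y) * w u)).
    move=> ce e1'.
    rewrite (_ : (fun y => _) = (fun y => oscint e (fun u => e (u * x) * w u) y * f y)).
      apply: integrable_oscintM => //.
      apply: (@integrable_boundedM _ 1) => //.
      by apply: (measurableT_comp (continuous_measurable_fun ce)); exact: measurable_funM.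
    apply/funext => y; rewrite mulrC; congr (_ * _); apply: eq_Rintegral => u _.
    by rewrite (mulrC u y); ring.
  rewrite /H !oscint_oscintM// -RintegralD//; last 2 first.
    exact: oi.
    exact: oi.
  apply: eq_Rintegral => y _; rewrite -mulrDr; congr (_ * _).
  rewrite -RintegralD//; last 2 first.
    exact: ik.
    exact: ik.
  rewrite /parabolic_kernel [RHS]Rintegral_mkcond; apply: eq_Rintegral => u _.
  rewrite /w /parabolic_weight !patchE; case: ifP => _; last by rewrite !mulr0 addr0.
  by rewrite (_ : u * (y - x) = u * y - u * x) ?cosB; ring.
have fHi : L1 (fun x => f x * H x).
  rewrite (_ : (fun x => f x * H x) = (fun x => f x * oscint cos (fun u => C f u * w u) x
     + f x * oscint sin (fun u => S f u * w u) x)).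
    exact: (integrableRD fCi fSi).
  by apply/funext => x; rewrite /H; ring.
have wi2 : L1 (fun u => w u * (C f u ^+ 2 + S f u ^+ 2)).
  rewrite (_ : (fun u => _) = (fun u => C f u * w u * C f u + S f u * w u * S f u)).
    exact: (integrableRD wCCi wSSi).
  by apply/funext => u; ring.
pose k z := 10 * cauchy_kernel a z.
have mk : measurable_fun [set: R] k.
  apply: measurable_funM => //.
  by apply: continuous_measurable_fun; exact: continuous_cauchy_kernel.
have k0 z : 0 <= k z by rewrite mulr_ge0// cauchy_kernel_ge0// ltW.
have kN z : k (- z) = k z by rewrite /k cauchy_kernelN.
have kI : (\int[mu]_z (k z)%:E = (10 * pi)%:E)%E.
  under eq_integral do rewrite EFinM.
  rewrite ge0_integralZl//; last 2 first.
  - by apply/measurable_EFinP; apply: continuous_measurable_fun; exact: continuous_cauchy_kernel.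
  - by move=> z _; rewrite lee_fin cauchy_kernel_ge0// ltW.
  by rewrite integral_cauchy_kernel.
(* Schur's test asks for a nonnegative kernel, so absolute values are taken in both integrals and
   [parabolic_kernel a] gives way to its majorant [k]. *)
apply: le_trans (schur_even mk k0 kN kI mf).
rewrite -[leLHS]fineK; last exact: (integrable_fin_num _ wi2).
rewrite -/(Rintegral mu setT _) e1.
apply: (@le_trans _ _ (\int[mu]_x `|(f x * H x)%:E|)%E).
  apply: (@le_trans _ _ `|\int[mu]_x (f x * H x)|%:E); first by rewrite lee_fin ler_norm.
  rewrite EFin_normr_Rintegral//; apply: le_abse_integral => //.
  by apply/measurable_EFinP; exact: measurable_funM.
have mkd : measurable_fun [set: R * R] (fun p : R * R => k (p.2 - p.1)).
  by apply: (measurableT_comp mk); apply: measurable_funB.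
apply: ge0_le_integral => //=.
- by apply/measurable_EFinP; apply: measurableT_comp => //; exact: measurable_funM.
- have := @measurable_fun_fubini_tonelli_F _ _ _ _ _ mu
    (fun p : R * R => (`|f p.1| * (`|f p.2| * k (p.2 - p.1)))%:E); apply.
    apply/measurable_EFinP; apply: measurable_funM.
      by apply: measurableT_comp => //; exact: (measurableT_comp mf).
    apply: measurable_funM => //.
    by apply: measurableT_comp => //; exact: (measurableT_comp mf).
  by move=> p; rewrite lee_fin mulr_ge0// mulr_ge0//; exact: k0.
- move=> x _; rewrite normrM EFinM.
  under eq_integral do rewrite EFinM.
  have mfk : measurable_fun [set: R] (fun y => `|f y| * k (y - x)).
    apply: measurable_funM; first exact: measurableT_comp.
    by apply: (measurableT_comp mk); exact: measurable_funB.
  rewrite ge0_integralZl//; last 2 first.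
  + exact/measurable_EFinP.
  + by move=> y _; rewrite lee_fin mulr_ge0.
  apply: lee_wpmul2l => //; rewrite HE.
  have mfK : measurable_fun [set: R] (fun y => f y * parabolic_kernel a (y - x)).
    apply: measurable_funM => //.
    apply: (@measurableT_comp _ _ _ _ _ _ (parabolic_kernel a)); last exact: measurable_funB.
    rewrite parabolic_kernel_oscint; apply: continuous_measurable_fun.
    exact: continuous_oscint.
  have Kk y : `|f y * parabolic_kernel a (y - x)| <= `|f y| * k (y - x).
    by rewrite normrM ler_wpM2l// le_parabolic_kernel.
  have ifK : L1 (fun y => f y * parabolic_kernel a (y - x)).
    rewrite (_ : (fun y => _) = (fun y => parabolic_kernel a (y - x) * f y)); last first.
      by apply/funext => y; rewrite mulrC.
    rewrite parabolic_kernel_oscint.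
    apply: (@integrable_boundedM _ (\int[mu]_u `|w u|)) => //; last by move=> y; exact: le_oscint.
    apply: (@measurableT_comp _ _ _ _ _ _ (C w)); last exact: measurable_funB.
    by apply: continuous_measurable_fun; exact: continuous_oscint.
  rewrite EFin_normr_Rintegral//.
  apply: le_trans (le_abse_integral _ _ _) _ => //; first exact/measurable_EFinP.
  apply: ge0_le_integral => //.
  + by apply/measurable_EFinP; exact: measurableT_comp.
  + exact/measurable_EFinP.
  + by move=> y _; rewrite lee_fin.
Qed.

(** With [a] twice the half-length of the interval, [|u / a| <= 1/2] there, so the weight is at
    least 3/4, hence at least 1/2. This costs the factor 2 that turns [10 * pi] into [20 * pi]. *)
Lemma plancherel_le (f : R -> R) : L1 f ->
  (\int[mu]_u (C f u ^+ 2 + S f u ^+ 2)%:E <=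
   (20 * pi)%:E * \int[mu]_x (f x ^+ 2)%:E)%E.
Proof.
move=> fi; have [mf foo] := (integrableRP f).1 fi.
have m1 : measurable_fun [set: R] (fun u => C f u ^+ 2 + S f u ^+ 2).
  apply: measurable_funD; apply: measurable_funX; apply: continuous_measurable_fun;
    apply: continuous_oscint => //; [exact: continuous_cos|exact: cos_max|exact: continuous_sin|exact: sin_max].
have p0 u : 0 <= C f u ^+ 2 + S f u ^+ 2 by rewrite addr_ge0// sqr_ge0.
apply: ge0_integral_le_itv.
- exact/measurable_EFinP.
- by move=> u; rewrite lee_fin.
(* For [n = 0] the interval is a point, and [a] would not be positive. *)
move=> [|n].
  rewrite mulr0n oppr0 set_itv1 integral_set1.
  by rewrite mule_ge0// ?lee_fin ?mulr_ge0 ?pi_ge0//; apply: integral_ge0 => x _; rewrite lee_fin sqr_ge0.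
pose a : R := 2 * n.+1%:R.
have n0 : 0 < n.+1%:R :> R by rewrite ltr0n.
have a0 : 0 < a by rewrite /a; lra.
have mw : measurable_fun [set: R] (fun u => parabolic_weight a u * (C f u ^+ 2 + S f u ^+ 2)).
  apply: measurable_funM => //.
  by have [] := (integrableRP (parabolic_weight a)).1 (integrable_parabolic_weight a).
have w0 u : 0 <= parabolic_weight a u.
  rewrite /parabolic_weight patchE; case: ifPn => //; rewrite inE/= in_itv/= -ler_norml => ua.
  rewrite subr_ge0 -real_normK ?num_real// expr_le1// normrM normfV (gtr0_norm a0).
  by rewrite ler_pdivrMr// mul1r.
have -> : (20 * pi)%:E = (2%:E * (10 * pi)%:E)%E :> \bar R.
  by rewrite -EFinM; congr EFin; ring.
rewrite -muleA.
apply: (@le_trans _ _ (2%:E * \int[mu]_u (parabolic_weight a u * (C f u ^+ 2 + S f u ^+ 2))%:E)%E); last first.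
  by apply: lee_wpmul2l; [rewrite lee_fin|exact: plancherel_weighted].
rewrite -ge0_integralZl//; last 2 first.
- exact/measurable_EFinP.
- by move=> u _; rewrite lee_fin mulr_ge0.
apply: (@le_trans _ _ (\int[mu]_(u in `[(- n.+1%:R)%R, n.+1%:R%R])
    (2%:E * (parabolic_weight a u * (C f u ^+ 2 + S f u ^+ 2))%:E))%E); last first.
  apply: ge0_subset_integral => //.
  - by apply: emeasurable_funM => //; exact/measurable_EFinP.
  - by move=> u _; rewrite mule_ge0// lee_fin mulr_ge0.
apply: ge0_le_integral => //.
- by move=> u _; rewrite lee_fin.
- by apply: measurable_funTS; exact/measurable_EFinP.
- by apply: measurable_funTS; apply: emeasurable_funM => //; exact/measurable_EFinP.
- move=> u; rewrite /= in_itv/= => un.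
  rewrite -EFinM lee_fin mulrA ler_peMl//.
  have ua : `|u / a| <= 2^-1.
    rewrite normrM normfV (gtr0_norm a0) ler_pdivrMr// /a.
    by rewrite mulKf// ler_norml.
  rewrite /parabolic_weight patchE ifT; last first.
    by rewrite inE/= in_itv/=; case/andP: un => u1 u2; rewrite /a; apply/andP; split; lra.
  rewrite -real_normK ?num_real//; have := normr_ge0 (u / a); nra.
Qed.

End oscillatory.

(** * Smooth steps *)

Section smooth.
Context {R : realType}.

(** Asks for [n] successive derivatives everywhere; over all [n] this is the usual smoothness.
    Recursing on [derive1 f] lets the closure properties be proved by induction from the rules for
    one derivative. *)
Fixpoint Ck (n : nat) (f : R -> R) : Prop :=
  if n is m.+1 then (forall x, derivable f x 1) /\ Ck m (derive1 f) else True.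

Definition smooth (f : R -> R) := forall n, Ck n f.

Lemma CkS n f : Ck n.+1 f -> Ck n f.
Proof.
by elim: n f => [//|n IHn] f [df Cf]; split => //; exact: IHn.
Qed.

Lemma smooth_derivable f x : smooth f -> derivable f x 1.
Proof. by move=> /(_ 1%N)[]. Qed.

Lemma smooth_derive1 f : smooth f -> smooth (derive1 f).
Proof. by move=> sf n; have [] := sf n.+1. Qed.

Lemma smooth_derivable_derive1n f n x : smooth f -> derivable (derive1n n f) x 1.
Proof.
elim: n f => [|n IHn] f sf; first exact: smooth_derivable.
by rewrite derive1Sn; apply: IHn; exact: smooth_derive1.
Qed.

Lemma smooth_continuous f : smooth f -> continuous f.
Proof.
move=> sf x; apply: differentiable_continuous; apply/derivable1_diffP.
exact: smooth_derivable.
Qed.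

Lemma CkD n f g : Ck n f -> Ck n g -> Ck n (fun x => f x + g x).
Proof.
elim: n f g => [//|n IHn] f g [df Cf] [dg Cg]; split.
  by move=> x; exact: derivableD.
rewrite (_ : derive1 (fun x => _) = (fun x => derive1 f x + derive1 g x)); first exact: IHn.
by apply/funext => x; rewrite !derive1E; exact: deriveD.
Qed.

Lemma Ck_cst n (c : R) : Ck n (fun=> c).
Proof.
elim: n c => [//|n IHn] c; split; first by move=> x; exact: derivable_cst.
rewrite (_ : derive1 (fun=> c) = fun=> 0); first exact: IHn.
by apply/funext => x; rewrite derive1_cst.
Qed.

Lemma CkM n f g : Ck n f -> Ck n g -> Ck n (fun x => f x * g x).
Proof.
elim: n f g => [//|n IHn] f g Cf Cg; have [df Cf'] := Cf; have [dg Cg'] := Cg; split.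
  by move=> x; exact: derivableM.
rewrite (_ : derive1 (fun x => _) = (fun x => f x * derive1 g x + g x * derive1 f x)).
  by apply: CkD; apply: IHn => //; exact: CkS.
apply/funext => x; rewrite !derive1E; exact: deriveM.
Qed.

Lemma is_derive_affine (f : R -> R) (a b x : R) : derivable f (a * x + b) 1 ->
  is_derive x 1 (fun x => f (a * x + b)) (a * derive1 f (a * x + b)).
Proof.
move=> df; rewrite derive1E mulrC.
apply: (@is_derive1_comp _ f (fun x => a * x + b)).
  exact: derivableP.
apply: is_derive_eq; rewrite /GRing.scale/=; ring.
Qed.

Lemma Ck_affine n f (a b : R) : Ck n f -> Ck n (fun x => f (a * x + b)).
Proof.
elim: n f => [//|n IHn] f [df Cf]; split.
  by move=> x; have /(_ (df _))[] := @is_derive_affine f a b x.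
rewrite (_ : derive1 (fun x => _) = (fun x => a * derive1 f (a * x + b))).
  by apply: CkM; [exact: Ck_cst|exact: IHn].
apply/funext => x; rewrite derive1E.
by have /(_ (df _))[] := @is_derive_affine f a b x.
Qed.

(** For [k = 0] this is the classical smooth function that is flat at the origin. The powers of
    [x^-1] are included because the derivative of a member of the family is a linear combination of
    two others, so smoothness of all of them follows by one induction. *)
Definition flat (k : nat) (x : R) : R := if 0 < x then x^-1 ^+ k * expR (- x^-1) else 0.

Lemma flat_ge0 k x : 0 <= flat k x.
Proof.
by rewrite /flat; case: ifPn => // x0; rewrite mulr_ge0 ?expR_ge0// exprn_ge0// invr_ge0 ltW.
Qed.

Lemma flat_gt0 k x : 0 < x -> 0 < flat k x.
Proof. by move=> x0; rewrite /flat x0 mulr_gt0 ?expR_gt0// exprn_gt0// invr_gt0. Qed.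

Lemma flat_le0 k x : x <= 0 -> flat k x = 0.
Proof. by move=> x0; rewrite /flat ltNge x0. Qed.

(** For [x > 0], the exponential of [x^-1] dominates the term of degree [k + 2] of its series. *)
Lemma flat_le k x : `|flat k x| <= k.+2`!%:R * x ^+ 2.
Proof.
rewrite ger0_norm ?flat_ge0//; have [x0|x0] := ltP 0 x; last first.
  by rewrite flat_le0// mulr_ge0// sqr_ge0.
rewrite /flat x0 expRN ler_pdivrMr ?expR_gt0//.
have x0' : 0 <= x^-1 by rewrite invr_ge0 ltW.
have : x^-1 ^+ k.+2 / k.+2`!%:R <= expR (x^-1).
  by apply: le_trans (expR_ge1Dxn k.+1 x0'); rewrite lerDr.
rewrite ler_pdivrMr ?ltr0n ?fact_gt0// => h.
rewrite -(ler_pM2l (_ : 0 < x^-1 ^+ 2)) ?exprn_gt0 ?invr_gt0//.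
rewrite -exprD add2n; apply: (le_trans h).
rewrite le_eqVlt; apply/orP; left; apply/eqP; field.
by rewrite gt_eqF.
Qed.

(* At the origin, [flat k] is [O(x^2)] by [flat_le]. *)
Lemma is_derive_flat k (x : R) : is_derive x (1 : R) (flat k) (flat k.+2 x - k%:R * flat k.+1 x).
Proof.
have [x0|x0|->] := ltgtP x 0.
- rewrite !flat_le0 ?(ltW x0)// mulr0 subr0.
  apply: (@near_eq_is_derive _ _ _ (fun=> 0)) => //.
  by near=> y; rewrite flat_le0//; apply/ltW; near: y; exact: lt_nbhsl.
- apply: (@near_eq_is_derive _ _ _ (fun y : R => y^-1 ^+ k * expR (- y^-1) : R)) => //.
    by near=> y; rewrite /flat ifT//; near: y; exact: lt_nbhsr.
  have xn0 : x != 0 by rewrite gt_eqF.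
  have dV : is_derive x (1 : R) (fun y : R => y^-1) (- x ^- 2).
    apply: DeriveDef; first exact: derivableV.
    by rewrite deriveV// derive_id /GRing.scale/= mulr1.
  rewrite /flat x0; case: k => [|k].
    by rewrite (_ : (fun y => _) = (fun y => expR (- y^-1)));
      [apply: is_derive_eq; rewrite /GRing.scale/=; field|
       apply/funext => y; rewrite expr0 mul1r].
  have dX : is_derive x (1 : R) (fun y : R => y^-1 ^+ k.+1) (k.+1%:R * x^-1 ^+ k * - x ^- 2).
    rewrite (_ : (fun y : R => _) = (fun y : R => y^-1) ^+ k.+1); first exact: is_deriveX.
    by apply/funext => y; rewrite exprfctE.
  have dE : is_derive x (1 : R) (fun y : R => expR (- y^-1)) (expR (- x^-1) * x ^- 2).
    by apply: is_derive_eq; rewrite opprK.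
  apply: (is_derive_eq (is_deriveM dX dE)); rewrite /GRing.scale/= !exprS; field.
  by [].
- rewrite !flat_le0// mulr0 subr0.
  have h : h^-1 *: (flat k (h *: 1 + 0) - flat k 0) @[h --> (0 : R)^'] --> (0 : R).
    apply/cvgr0Pnorm_le => e e0; near=> h.
    have hn0 : h != 0 by near: h; exact: nbhs_dnbhs_neq.
    rewrite [flat k 0]flat_le0// subr0 addr0 /GRing.scale/= mulr1 normrM normfV.
    rewrite ler_pdivrMl ?normr_gt0//; apply: (le_trans (flat_le k h)).
    rewrite -real_normK ?num_real// expr2 mulrA (mulrC `|h|) ler_wpM2r//.
    rewrite -ler_pdivlMl ?ltr0n ?fact_gt0//.
    near: h; apply: dnbhs0_le.
    by rewrite mulr_gt0// invr_gt0 ltr0n fact_gt0.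
  by apply: DeriveDef; [apply/cvg_ex; exists 0; exact: h|exact: cvg_lim h].
Unshelve. all: by end_near. Qed.

Lemma smooth_flat k : smooth (flat k).
Proof.
move=> n; elim: n k => [//|n IHn] k; split.
  by move=> x; have [] := is_derive_flat k x.
rewrite (_ : derive1 _ = fun x => flat k.+2 x + (- k%:R) * flat k.+1 x).
  by apply: CkD => //; apply: CkM => //; exact: Ck_cst.
by apply/funext => x; rewrite derive1E mulNr; have [] := is_derive_flat k x.
Qed.

Definition bump (x : R) : R := flat 0 x * flat 0 (1 - x).

Lemma smooth_bump : smooth bump.
Proof.
move=> n; apply: CkM; first exact: smooth_flat.
rewrite (_ : (fun x => _) = (fun x => flat 0 (-1 * x + 1))).
  by apply: Ck_affine; exact: smooth_flat.
by apply/funext => x; rewrite mulN1r addrC.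
Qed.

Lemma bump_ge0 x : 0 <= bump x.
Proof. by rewrite mulr_ge0 ?flat_ge0. Qed.

Lemma bump_le1 x : bump x <= 1.
Proof.
have h y : flat 0 y <= 1.
  rewrite /flat; case: ifPn => // y0.
  by rewrite expr0 mul1r -expR0 ler_expR oppr_le0 invr_ge0 ltW.
by rewrite mulr_ile1 ?flat_ge0.
Qed.

Lemma bump_gt0 x : 0 < x < 1 -> 0 < bump x.
Proof. by move=> /andP[x0 x1]; rewrite mulr_gt0 ?flat_gt0// subr_gt0. Qed.

Lemma bump_eq0 x : x <= 0 \/ 1 <= x -> bump x = 0.
Proof.
rewrite /bump => -[x0|x1]; first by rewrite flat_le0 ?mul0r.
by rewrite [flat 0 (1 - x)]flat_le0 ?mulr0// subr_le0.
Qed.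

End smooth.

(** * The primitive of the bump, and local integrability of square-integrable functions *)

Section step.
Context {R : realType}.
Local Notation mu := (@lebesgue_measure R).
Local Notation L1 f := (mu.-integrable [set: R] (EFin \o f)).
Local Notation bump := (@bump R).

Lemma integrable_bump : L1 bump.
Proof.
rewrite (_ : bump = bump \_ `[0, 1]); last first.
  apply/funext => x; rewrite patchE; case: ifPn => //.
  rewrite notin_setE/= in_itv/= => /negP; rewrite negb_and -!ltNge => h.
  by rewrite bump_eq0//; case/orP: h => /ltW; [left|right].
rewrite -restrict_EFin; apply/(integrable_mkcond _ _).1 => //.
apply: continuous_compact_integrable; first exact: segment_compact.
by apply: continuous_subspaceT; apply: smooth_continuous; exact: smooth_bump.
Qed.

Let mbump : measurable_fun [set: R] bump.
Proof. by have [] := (integrableRP bump).1 integrable_bump. Qed.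

Definition step (x : R) : R := \int[mu]_(t in `]-oo, x]) bump t.
(** The bump is left unnormalised; its mass multiplies both sides of the final estimate of
    [weak_derivative_translate_pt] and cancels there. *)
Definition bump_mass : R := \int[mu]_t bump t.

Lemma is_derive_step (x : R) : is_derive x (1 : R) step (bump x).
Proof.
have xu : x < x + 1 by rewrite ltrDl.
have iu : mu.-integrable `]-oo, (x + 1)] (EFin \o bump).
  by apply: (integrableS _ _ _ integrable_bump).
have [d e] := continuous_FTC1 xu iu (ltNyr _) (smooth_continuous (@smooth_bump R) (x := x)).
by apply: DeriveDef; [exact: d|rewrite -derive1E; exact: e].
Qed.

Lemma smooth_step : smooth step.
Proof.
case=> [//|n]; split; first by move=> x; have [] := is_derive_step x.
rewrite (_ : derive1 step = bump); first exact: smooth_bump.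
by apply/funext => x; rewrite derive1E; have [] := is_derive_step x.
Qed.

Lemma step_le0 x : x <= 0 -> step x = 0.
Proof.
move=> x0; rewrite /step (@eq_Rintegral _ _ _ _ _ (cst 0)).
  by rewrite Rintegral_cst// mul0r.
move=> y; rewrite inE/= in_itv/= => yx.
by rewrite bump_eq0//; left; exact: le_trans yx x0.
Qed.

Lemma step_ge1 x : 1 <= x -> step x = bump_mass.
Proof.
move=> x1; rewrite /step Rintegral_mkcond; apply: eq_Rintegral => y _.
rewrite patchE; case: ifPn => //; rewrite notin_setE/= in_itv/= => /negP.
by rewrite -ltNge => xy; rewrite bump_eq0//; right; exact: le_trans x1 (ltW xy).
Qed.

Lemma step_bound x : 0 <= step x <= bump_mass.
Proof.
apply/andP; split; first by apply: Rintegral_ge0 => y _; exact: bump_ge0.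
rewrite /step Rintegral_mkcond; apply: le_Rintegral => //.
- rewrite -restrict_EFin; apply/(integrable_mkcond _ _).1 => //.
  by apply: (integrableS _ _ _ integrable_bump).
- exact: integrable_bump.
- by move=> y _; rewrite patchE; case: ifP => // _; exact: bump_ge0.
Qed.

(** By the mean value theorem on [[0, 1]], the mass is a value of [bump] at an interior point. *)
Lemma bump_mass_gt0 : 0 < bump_mass.
Proof.
have [z z01] := @MVT R step bump 0 1 ltr01 (fun x _ => is_derive_step x)
  (continuous_subspaceT (smooth_continuous smooth_step)).
rewrite [step 0]step_le0// [step 1]step_ge1// !subr0 mulr1 => ->.
by apply: bump_gt0; move: z01; rewrite in_itv.
Qed.

(** On [[p, q]] the product is at most [M * |f| <= M * (1 + f ^+ 2)], and it vanishes outside. *)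
Lemma integrable_boundedM_L2 (k f : R -> R) (M p q : R) :
  measurable_fun [set: R] k -> (forall x, `|k x| <= M) ->
  (forall x, ~~ (p <= x <= q) -> k x = 0) ->
  measurable_fun [set: R] f -> L1 (fun x => f x ^+ 2) ->
  L1 (fun x => k x * f x).
Proof.
move=> mk kM k0 mf f2.
have M0 : 0 <= M by apply: le_trans (kM 0).
have i1 : L1 (fun x => (M * \1_`[p, q] x) + M * f x ^+ 2).
  apply: integrableRD.
    apply: (@integrable_boundedM _ M (cst M)) => //; first by move=> x /=; rewrite ger0_norm.
    exact: integrable_indic_itv.
  by apply: (@integrable_boundedM _ M (cst M)) => // x /=; rewrite ger0_norm.
apply: (le_integrable measurableT _ _ i1) => //.
  by apply/measurable_EFinP; exact: measurable_funM.
move=> x _ /=; rewrite lee_fin [leRHS]ger0_norm; last first.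
  by rewrite addr_ge0// mulr_ge0// sqr_ge0.
have [pxq|pxq] := boolP (p <= x <= q); last first.
  by rewrite k0// mul0r normr0 addr_ge0// mulr_ge0// sqr_ge0.
rewrite indicE mem_set//= mulr1 normrM.
apply: (@le_trans _ _ (M * `|f x|)); first by rewrite ler_wpM2r.
rewrite -(real_normK (num_real (f x))).
set y := `|f x|; have := mulr_ge0 M0 (sqr_ge0 (y - 1)); have := mulr_ge0 M0 (sqr_ge0 (y + 1)); nra.
Qed.

(** Makes the Lebesgue differentiation theorem available for square-integrable functions. *)
Lemma locally_integrable_L2 (f : R -> R) :
  measurable_fun [set: R] f -> L1 (fun x => f x ^+ 2) -> locally_integrable setT f.
Proof.
move=> mf f2; split => //; first exact: openT.
move=> K _ cK; have mK : measurable K by exact: compact_measurable.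
have [M [Mr KM]] := compact_bounded cK.
have i : L1 (fun x => \1_K x * f x).
  apply: (@integrable_boundedM_L2 _ _ 1 (- (M + 1)) (M + 1)) => //.
    by move=> x; rewrite indicE; case: (_ \in _); rewrite ?normr1 ?normr0.
  move=> x xM; rewrite indicE; case: (boolP (x \in K)) => //; rewrite inE => Kx.
  move: xM; rewrite -ler_norml (KM (M + 1))//.
  by rewrite ltrDl.
have [_] := (integrableRP _).1 i; apply: le_lt_trans.
rewrite integral_mkcond le_eqVlt; apply/orP; left; apply/eqP.
apply: eq_integral => x _; rewrite patchE indicE.
by case: (boolP (x \in K)) => _; rewrite ?mul1r ?mul0r ?normr0.
Qed.

(** Cauchy-Schwarz against the constant 1: with [l] the mean of [|f|] over [[p, q]], the integral of
    [(|f| - l) ^+ 2] is nonnegative; expand and multiply by [q - p]. *)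
Lemma sqr_Rintegral_itv_le (f : R -> R) (p q : R) : p < q ->
  measurable_fun [set: R] f -> L1 (fun x => f x ^+ 2) ->
  (\int[mu]_(x in `[p, q]) `|f x|) ^+ 2 <= (q - p) * \int[mu]_(x in `[p, q]) f x ^+ 2.
Proof.
move=> pq mf f2.
have L0 : 0 < q - p by rewrite subr_gt0.
have i2 : mu.-integrable `[p, q] (EFin \o (fun x => f x ^+ 2)).
  exact: (integrableS _ _ _ f2).
have i1 : mu.-integrable `[p, q] (EFin \o (fun x => `|f x|)).
  have i : L1 (fun x => \1_`[p, q] x * f x).
    apply: (@integrable_boundedM_L2 _ _ 1 p q) => //.
      by move=> x; rewrite indicE; case: (_ \in _); rewrite ?normr1 ?normr0.
    by move=> x xpq; rewrite indicE memNset//= in_itv/=; exact/negP.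
  have j : mu.-integrable `[p, q] (EFin \o (fun x => \1_`[p, q] x * f x)).
    exact: (integrableS _ _ _ i).
  have := integrable_norm j; apply: eq_integrable => // x xpq /=.
  by rewrite indicE xpq mul1r.
have ic (c : R) : mu.-integrable `[p, q] (EFin \o (cst c)).
  by apply: continuous_compact_integrable; [exact: segment_compact|apply: continuous_subspaceT; exact: cst_continuous].
set M := \int[mu]_(x in `[p, q]) `|f x|; set B := \int[mu]_(x in `[p, q]) f x ^+ 2.
pose l := M / (q - p).
have : 0 <= \int[mu]_(x in `[p, q]) (`|f x| - l) ^+ 2.
  by apply: Rintegral_ge0 => x _; exact: sqr_ge0.
have -> : \int[mu]_(x in `[p, q]) (`|f x| - l) ^+ 2 =
    \int[mu]_(x in `[p, q]) (f x ^+ 2 + (l ^+ 2 + (- (2 * l)) * `|f x|)).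
  apply: eq_Rintegral => x _; rewrite -(real_normK (num_real (f x))); ring.
have il : mu.-integrable `[p, q] (EFin \o (fun x => (- (2 * l)) * `|f x|)).
  exact: (integrableZl _ (- (2 * l)) i1).
rewrite RintegralD//; last exact: (integrableD _ (ic (l ^+ 2)) il).
rewrite RintegralD//; last exact: ic.
have -> : \int[mu]_(x in `[p, q]) l ^+ 2 = l ^+ 2 * (q - p).
  have := @Rintegral_cst _ _ _ mu `[p, q] (measurable_itv _) (l ^+ 2).
  by rewrite /= lebesgue_measure_itv/= lte_fin pq -EFinB/=.
rewrite RintegralZl//.
rewrite -/M -/B /l => h.
have : 0 <= (q - p) * (B + ((M / (q - p)) ^+ 2 * (q - p) + - (2 * (M / (q - p))) * M)).
  by rewrite mulr_ge0// ltW.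
have -> : (q - p) * (B + ((M / (q - p)) ^+ 2 * (q - p) + - (2 * (M / (q - p))) * M)) =
   (q - p) * B - M ^+ 2 by field; rewrite gt_eqF.
by rewrite subr_ge0.
Qed.

End step.

(** * Translates of weakly differentiable functions *)

Section mollifier.
Context {R : realType}.
Local Notation mu := (@lebesgue_measure R).
Local Notation L1 f := (mu.-integrable [set: R] (EFin \o f)).

(** One-sided approximate identity supported in [[x, x + r]], with the argument in the affine form
    of [Ck_affine]. *)
Definition mollifier (r x y : R) : R := r^-1 * bump (r^-1 * y + - (r^-1 * x)).

Lemma smooth_mollifier r x : smooth (mollifier r x).
Proof.
move=> n; apply: CkM; first exact: Ck_cst.
by apply: Ck_affine; exact: smooth_bump.
Qed.

Lemma measurable_mollifier r x : measurable_fun [set: R] (mollifier r x).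
Proof.
by apply: continuous_measurable_fun; apply: smooth_continuous; exact: smooth_mollifier.
Qed.

Lemma mollifier_ge0 r x y : 0 < r -> 0 <= mollifier r x y.
Proof. by move=> r0; rewrite mulr_ge0 ?bump_ge0// invr_ge0 ltW. Qed.

Lemma mollifier_le r x y : 0 < r -> `|mollifier r x y| <= r^-1.
Proof.
move=> r0; rewrite ger0_norm ?mollifier_ge0// /mollifier ler_piMr ?bump_le1//.
by rewrite invr_ge0 ltW.
Qed.

Lemma mollifier_eq0 r x y : 0 < r -> ~~ (x <= y <= x + r) -> mollifier r x y = 0.
Proof.
move=> r0; rewrite negb_and -!ltNge => h.
rewrite /mollifier bump_eq0 ?mulr0// -mulrBr; case/orP: h => h; [left|right].
  by rewrite pmulr_rle0 ?invr_gt0// subr_le0 ltW.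
by rewrite ler_pdivlMl// mulr1 lerBrDl ltW.
Qed.

Lemma integrable_mollifierM r x (f : R -> R) : 0 < r ->
  measurable_fun [set: R] f -> L1 (fun x => f x ^+ 2) ->
  L1 (fun y => mollifier r x y * f y).
Proof.
move=> r0 mf f2.
apply: (@integrable_boundedM_L2 _ _ _ r^-1 x (x + r)) => //.
- exact: measurable_mollifier.
- by move=> y; exact: mollifier_le.
- by move=> y; exact: mollifier_eq0.
Qed.

Lemma integrable_mollifier r x : 0 < r -> L1 (mollifier r x).
Proof.
move=> r0; rewrite (_ : mollifier r x = mollifier r x \_ `[x, x + r]); last first.
  apply/funext => y; rewrite patchE; case: ifPn => //.
  rewrite notin_setE/= in_itv/= => /negP h; exact: mollifier_eq0.
rewrite -restrict_EFin; apply/(integrable_mkcond _ _).1 => //.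
apply: continuous_compact_integrable; first exact: segment_compact.
by apply: continuous_subspaceT; apply: smooth_continuous; exact: smooth_mollifier.
Qed.

Let S r x (y : R) := step (r^-1 * y + - (r^-1 * x)).

Lemma is_derive_stepS r x y : is_derive y (1 : R) (S r x) (mollifier r x y).
Proof.
rewrite /mollifier.
have -> : bump (r^-1 * y + - (r^-1 * x)) = derive1 step (r^-1 * y + - (r^-1 * x)).
  by rewrite derive1E; have [_ ->] := is_derive_step (r^-1 * y + - (r^-1 * x)).
apply: is_derive_affine.
by have [] := is_derive_step (r^-1 * y + - (r^-1 * x)).
Qed.

Lemma Rintegral_mollifier r x : 0 < r -> \int[mu]_y mollifier r x y = (@bump_mass R).
Proof.
move=> r0.
have -> : \int[mu]_y mollifier r x y = \int[mu]_(y in `[x, x + r]) mollifier r x y.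
  rewrite [RHS]Rintegral_mkcond; apply: eq_Rintegral => y _; rewrite patchE; case: ifPn => //.
  rewrite notin_setE/= in_itv/= => /negP h; exact: mollifier_eq0.
have cS : continuous (S r x).
  move=> y; apply: differentiable_continuous; apply/derivable1_diffP.
  by have [] := is_derive_stepS r x y.
rewrite /Rintegral (@continuous_FTC2 _ _ (S r x)) ?ltrDl//.
- rewrite -EFinB/= /S step_ge1; last by rewrite -mulrBr addrC addKr mulVf// gt_eqF.
  by rewrite step_le0 ?subr0// subrr.
- by apply: continuous_subspaceT; apply: smooth_continuous; exact: smooth_mollifier.
- split; first by move=> y _; have [] := is_derive_stepS r x y.
    by apply: cvg_at_right_filter; exact: cS.
  by apply: cvg_at_left_filter; exact: cS.
- by move=> y _; rewrite derive1E; have [] := is_derive_stepS r x y.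
Qed.

(** For [r <= t] it rises on [[x, x + r]], stays at [bump_mass] until [x + t], and falls on
    [[x + t, x + t + r]]. Its derivative is the difference of the mollifiers at [x] and [x + t], so
    testing against it compares [f] at these two points. *)
Definition plateau (r x t y : R) : R := S r x y - S r (x + t) y.

Lemma derive1_plateau r x t y :
  derive1 (plateau r x t) y = mollifier r x y - mollifier r (x + t) y.
Proof.
rewrite derive1E; have d1 := is_derive_stepS r x y; have d2 := is_derive_stepS r (x + t) y.
by have [] := is_deriveB d1 d2.
Qed.

Lemma smooth_plateau r x t : smooth (plateau r x t).
Proof.
move=> n; rewrite (_ : plateau r x t = (fun y => S r x y + (-1) * S r (x + t) y)).
  apply: CkD; first by apply: Ck_affine; exact: smooth_step.
  apply: CkM; first exact: Ck_cst.
  by apply: Ck_affine; exact: smooth_step.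
by apply/funext => y; rewrite mulN1r.
Qed.

Lemma plateau_eq0 r x t y : 0 < r -> 0 < t -> ~~ (x <= y <= x + t + r) ->
  plateau r x t y = 0.
Proof.
move=> r0 t0; rewrite negb_and -!ltNge /plateau /S -!mulrBr => /orP[h|h].
  by rewrite !step_le0 ?subrr// pmulr_rle0 ?invr_gt0// subr_le0; lra.
by rewrite !step_ge1 ?subrr// ler_pdivlMl// mulr1; lra.
Qed.

Lemma test_function_plateau r x t : 0 < r -> 0 < t -> test_function (plateau r x t).
Proof.
move=> r0 t0; split.
  by move=> n y; apply: smooth_derivable_derive1n; exact: smooth_plateau.
exists (`|x| + t + r) => y xy; apply: plateau_eq0 => //.
apply/negP => /andP[y1 y2].
have := ler_norm x; have := ler_norm (- x); rewrite normrN => n1 n2.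
move: xy; rewrite ltNge => /negP; apply; rewrite ler_norml; apply/andP; split; lra.
Qed.

Lemma plateau_le r x t y : `|plateau r x t y| <= (@bump_mass R).
Proof.
have /andP[a1 a2] := step_bound (r^-1 * y + - (r^-1 * x)).
have /andP[b1 b2] := step_bound (r^-1 * y + - (r^-1 * (x + t))).
by rewrite /plateau /S ler_norml; apply/andP; split; lra.
Qed.

(** The mollifier is at most [r^-1], so the error is controlled by the mean of [|f y - f x|] near
    [x], which tends to 0 at a Lebesgue point. *)
Lemma cvg_mollifier (f : R -> R) (x : R) :
  measurable_fun [set: R] f -> L1 (fun x => f x ^+ 2) -> lebesgue_pt f x ->
  \int[mu]_y (mollifier r x y * f y) @[r --> 0^'+] --> (@bump_mass R) * f x.
Proof.
move=> mf f2 fx.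
apply/cvgrPdist_le => e e0.
have : \forall r \near (0 : R)^'+, (davg f x r < (e / 4)%:E)%E.
  move/fine_cvgP : fx => [finx cvgx]; near=> r.
  have fr : davg f x r \is a fin_num by near: r.
  rewrite -(fineK fr) lte_fin; near: r; apply: (cvgr_lt _ cvgx).
  by rewrite divr_gt0.
move=> [d /= d0 hd]; near=> r.
have r0 : 0 < r by near: r; exact: nbhs_right_gt.
have i1 := integrable_mollifierM x r0 mf f2.
have i2 : L1 (fun y => f x * mollifier r x y).
  exact: (integrableZl _ (f x) (integrable_mollifier x r0)).
rewrite -(Rintegral_mollifier x r0) mulrC -(RintegralZl (f x) measurableT (integrable_mollifier x r0)).
rewrite -RintegralB//.
have -> : \int[mu]_y (f x * mollifier r x y - mollifier r x y * f y) =
    \int[mu]_y (mollifier r x y * (f x - f y)).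
  by apply: eq_Rintegral => y _; ring.
rewrite -lee_fin.
have i3 : L1 (fun y => mollifier r x y * (f x - f y)).
  rewrite (_ : (fun y => _) = (fun y => f x * mollifier r x y - mollifier r x y * f y)).
    exact: (integrableRB i2 i1).
  by apply/funext => y; ring.
rewrite EFin_normr_Rintegral//.
(* The open ball of radius [2 * r] contains the closed interval [[x, x + r]]. Its measure is
   [4 * r], so integrating [r^-1] times the distance over it is 4 times the mean. *)
apply: (@le_trans _ _ (4%:E * davg f x (2 * r))%E); last first.
  rewrite -lee_pdivlMl// -EFinM [4^-1 * e]mulrC ltW//; apply: hd; last by rewrite mulr_gt0.
  rewrite /ball/= sub0r normrN gtr0_norm ?mulr_gt0// -ltr_pdivlMl//.
  by near: r; apply: nbhs_right_lt; rewrite mulr_gt0.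
have r20 : 0 < 2 * r by rewrite mulr_gt0.
apply: (@le_trans _ _ (\int[mu]_y `|mollifier r x y * (f x - f y)|%:E)%E).
  by apply: le_abse_integral => //; have [] := integrableP _ _ _ i3.
rewrite /davg /iavg lebesgue_measure_ball; last exact: ltW.
have md : measurable_fun [set: R] (fun y => f y - f x) by exact: measurable_funB.
apply: (@le_trans _ _ (\int[mu]_(y in ball x (2 * r)) (r^-1%:E * `|(f y - f x)%:E|))%E).
  rewrite [leRHS]integral_mkcond; apply: ge0_le_integral => //.
  - by apply/measurable_EFinP; apply: measurableT_comp => //; apply: measurable_funM;
     [exact: measurable_mollifier|exact: measurable_funB].
  - apply/(measurable_restrictT _ _).1; first exact: measurable_ball.
    apply: measurable_funTS; apply: emeasurable_funM => //.
    by apply: measurableT_comp => //; exact/measurable_EFinP.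
  - move=> y _; rewrite patchE; case: ifPn => [_|].
      rewrite -EFinM lee_fin normrM distrC ler_wpM2r//; exact: mollifier_le.
    rewrite notin_setE/= /ball/= => yr; rewrite mollifier_eq0 ?mul0r ?normr0//.
    apply/negP => /andP[y1 y2]; apply: yr; rewrite distrC ger0_norm ?subr_ge0//; lra.
rewrite ge0_integralZl//; last 3 first.
- exact: measurable_ball.
- by apply: measurable_funTS; apply: measurableT_comp => //; exact/measurable_EFinP.
- by rewrite lee_fin invr_ge0 ltW.
rewrite muleA le_eqVlt; apply/orP; left; apply/eqP; congr (_ * _)%E.
rewrite inver mulrn_eq0/= gt_eqF// -EFinM; congr EFin; rewrite -mulr_natl; field.
by rewrite gt_eqF.
Unshelve. all: by end_near. Qed.

(** For [r <= t] all plateaus live in [[x, x + 2 * t]], a set independent of [r]. The limit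
    [r --> 0] bounds [|f (x + t) - f x|] by the integral of [|g|] over it, and Cauchy-Schwarz on its
    length [2 * t] gives the square. *)
Lemma weak_derivative_translate_pt (f g : R -> R) (x t : R) : 0 < t ->
  measurable_fun [set: R] f -> L1 (fun x => f x ^+ 2) ->
  measurable_fun [set: R] g -> L1 (fun x => g x ^+ 2) ->
  (forall phi, test_function phi ->
    \int[mu]_y (f y * derive1 phi y) = - \int[mu]_y (g y * phi y)) ->
  lebesgue_pt f x -> lebesgue_pt f (x + t) ->
  (f (x + t) - f x) ^+ 2 <= 2 * t * \int[mu]_(y in `[x, x + 2 * t]) g y ^+ 2.
Proof.
move=> t0 mf f2 mg g2 fg fx fxt.
have c0 := @bump_mass_gt0 R; set c := @bump_mass R in c0 *.
set B := \int[mu]_(y in `[x, x + 2 * t]) `|g y|.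
have B0 : 0 <= B by apply: Rintegral_ge0.
suff : `|c * f (x + t) - c * f x| <= c * B.
  rewrite -mulrBr normrM gtr0_norm// ler_pM2l// => h.
  apply: le_trans (_ : B ^+ 2 <= _).
    by rewrite -(real_normK (num_real (f (x + t) - f x))) lerXn2r// nnegrE.
  have -> : 2 * t = x + 2 * t - x by ring.
  rewrite (_ : x + (x + 2 * t - x) = x + 2 * t); last by ring.
  by apply: sqr_Rintegral_itv_le => //; lra.
have h : `|\int[mu]_y (mollifier r (x + t) y * f y) - \int[mu]_y (mollifier r x y * f y)|
     @[r --> 0^'+] --> `|c * f (x + t) - c * f x|.
  by apply: cvg_norm; apply: cvgB; exact: cvg_mollifier.
apply: (cvgr_to_le h).
near=> r.
have r0 : 0 < r by near: r; exact: nbhs_right_gt.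
have rt : r <= t by near: r; exact: nbhs_right_le.
have i1 := integrable_mollifierM x r0 mf f2.
have i2 := integrable_mollifierM (x + t) r0 mf f2.
have ip : L1 (fun y => plateau r x t y * g y).
  apply: (@integrable_boundedM_L2 _ _ _ c x (x + t + r)) => //.
  - by apply: continuous_measurable_fun; apply: smooth_continuous; exact: smooth_plateau.
  - by move=> y; exact: plateau_le.
  - by move=> y; exact: plateau_eq0.
rewrite distrC -RintegralB//.
have -> : \int[mu]_y (mollifier r x y * f y - mollifier r (x + t) y * f y) =
    \int[mu]_y (f y * derive1 (plateau r x t) y).
  by apply: eq_Rintegral => y _; rewrite derive1_plateau; ring.
rewrite fg; last exact: test_function_plateau.
have -> : \int[mu]_y (g y * plateau r x t y) = \int[mu]_y (plateau r x t y * g y).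
  by apply: eq_Rintegral => y _; rewrite mulrC.
rewrite normrN.
apply: (le_trans (le_normr_Rintegral measurableT ip)).
have ig : L1 (fun y => \1_`[x, x + 2 * t] y * g y).
  apply: (@integrable_boundedM_L2 _ _ _ 1 x (x + 2 * t)) => //.
    by move=> y; rewrite indicE; case: (_ \in _); rewrite ?normr1 ?normr0.
  by move=> y yx; rewrite indicE memNset//= in_itv/=; exact/negP.
have -> : c * B = \int[mu]_y (c * `|\1_`[x, x + 2 * t] y * g y|).
  rewrite (RintegralZl c measurableT (integrable_norm ig)) /B; congr (_ * _).
  rewrite [LHS]Rintegral_mkcond; apply: eq_Rintegral => y _; rewrite patchE /= indicE.
  by case: ifP => yI; rewrite ?mul1r// mul0r normr0.
apply: le_Rintegral => //.
- exact: integrable_norm ip.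
- exact: (integrableZl _ c (integrable_norm ig)).
move=> y _; rewrite !normrM mulrA ler_wpM2r// indicE.
have [yI|yI] := boolP (y \in `[x, x + 2 * t]%classic).
  by rewrite normr1 mulr1 plateau_le.
rewrite plateau_eq0 ?normr0 ?mulr0//; apply: contra yI => /andP[y1 y2].
by rewrite inE/= in_itv/= y1/=; lra.
Unshelve. all: by end_near. Qed.

End mollifier.

Section translate.
Context {R : realType}.
Local Notation mu := (@lebesgue_measure R).
Local Notation L1 f := (mu.-integrable [set: R] (EFin \o f)).

Lemma ae_addr (P : R -> Prop) (t : R) :
  {ae mu, forall x, P x} -> {ae mu, forall x, P (x + t)}.
Proof.
move=> [N [mN N0 PN]]; exists ((fun x : R => x + t) @^-1` N); split.
- by rewrite -[X in measurable X]setTI; exact: (measurable_addr t).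
- by have := lebesgue_measure_addr t mN; rewrite /pushforward => ->.
- by move=> x xP; apply: PN.
Qed.

(** Almost every [x] is a Lebesgue point together with [x + t], so the pointwise bound can be
    integrated. By Tonelli each [y] lies in [[x, x + 2 * t]] for a set of [x] of length [2 * t];
    this second factor [2 * t] makes the constant [4 * t ^+ 2]. *)
Lemma weak_derivative_translate_le (f g : R -> R) (t : R) : 0 < t ->
  measurable_fun [set: R] f -> L1 (fun x => f x ^+ 2) ->
  measurable_fun [set: R] g -> L1 (fun x => g x ^+ 2) ->
  (forall phi, test_function phi ->
    \int[mu]_y (f y * derive1 phi y) = - \int[mu]_y (g y * phi y)) ->
  (\int[mu]_x ((f (x + t) - f x) ^+ 2)%:E <= (4 * t ^+ 2)%:E * \int[mu]_x (g x ^+ 2)%:E)%E.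
Proof.
move=> t0 mf f2 mg g2 fg.
have aef := lebesgue_differentiation (locally_integrable_L2 mf f2).
have aeft := ae_addr t aef.
pose G (p : R * R) : \bar R := (g p.2 ^+ 2 * \1_`[0, 2 * t] (p.2 - p.1))%:E.
have mI : measurable_fun [set: R] (\1_`[0, 2 * t] : R -> R) by exact: measurable_indic.
have mgg : measurable_fun [set: R * R] (fun p : R * R => g p.2).
  exact: (measurableT_comp mg).
have mG : measurable_fun [set: R * R] G.
  apply/measurable_EFinP; apply: measurable_funM.
    exact: measurable_funX.
  by apply: (measurableT_comp mI); exact: measurable_funB.
have G0 p : (0 <= G p)%E by rewrite lee_fin mulr_ge0// sqr_ge0.
have mGF : measurable_fun [set: R] (fun x => \int[mu]_y G (x, y))%E.
  exact: (@measurable_fun_fubini_tonelli_F _ _ _ _ _ mu G mG G0).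
have mft : measurable_fun [set: R] (fun x => f (x + t)).
  by apply: (measurableT_comp mf); exact: measurable_addr.
apply: (@le_trans _ _ (\int[mu]_x ((2 * t)%:E * \int[mu]_y G (x, y)))%E).
  apply: ae_ge0_le_integral => //.
  - by move=> x _; rewrite lee_fin sqr_ge0.
  - by apply/measurable_EFinP; apply: measurable_funX; exact: measurable_funB.
  - by move=> x _; apply: mule_ge0; [rewrite lee_fin mulr_ge0// ltW|exact: integral_ge0].
  - exact: emeasurable_funM.
  have FF := ae_filter_ringOfSetsType mu.
  apply: (@filterS2 _ _ FF _ _ _ _ aef aeft) => x fx fxt _.
  have := weak_derivative_translate_pt t0 mf f2 mg g2 fg fx fxt.
  rewrite -lee_fin => /le_trans; apply; rewrite EFinM lee_wpmul2l//.
    by rewrite lee_fin mulr_ge0// ltW.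
  rewrite fineK; last first.
    by apply: integrable_fin_num => //; exact: (integrableS _ _ _ g2).
  rewrite integral_mkcond le_eqVlt; apply/orP; left; apply/eqP.
  apply: eq_integral => y _; rewrite patchE /G/= indicE.
  have -> : (y - x \in `[0, 2 * t]%classic) = (y \in `[x, x + 2 * t]%classic).
    by apply/idP/idP; rewrite !inE/= !in_itv/= => /andP[h1 h2]; apply/andP; split; lra.
  by case: ifP => _; rewrite ?mulr1 ?mulr0.
have t20 : (0 <= (2 * t)%:E :> \bar R)%E by rewrite lee_fin mulr_ge0// ltW.
rewrite ge0_integralZl//; last by move=> x _; exact: integral_ge0.
rewrite (@fubini_tonelli _ _ _ _ _ mu mu G)//.
have -> : (\int[mu]_y \int[mu]_x G (x, y) = (2 * t)%:E * \int[mu]_y (g y ^+ 2)%:E)%E.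
  rewrite -ge0_integralZl//; last 2 first.
  - by apply/measurable_EFinP; exact: measurable_funX.
  - by move=> y _; rewrite lee_fin sqr_ge0.
  apply: eq_integral => y _; rewrite /G/=.
  under eq_integral do rewrite EFinM.
  rewrite ge0_integralZl//; last 2 first.
  - by apply/measurable_EFinP; apply: (measurableT_comp mI); exact: measurable_funB.
  - by rewrite lee_fin sqr_ge0.
  rewrite muleC; congr (_ * _)%E.
  have -> : (\int[mu]_x (\1_`[0%R, (2 * t)%R] (y - x)%R)%:E = \int[mu]_x (\1_`[(y - 2 * t)%R, y] x)%:E)%E.
    apply: eq_integral => x _; rewrite !indicE; congr ((nat_of_bool _)%:R%:E).
    by apply/idP/idP; rewrite !inE/= !in_itv/= => /andP[h1 h2]; apply/andP; split; lra.
  rewrite integral_indic//= setIT lebesgue_measure_itv/= lte_fin.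
  rewrite ifT; last by rewrite ltrBlDr ltrDl mulr_gt0.
  by rewrite -EFinB; congr EFin; ring.
by rewrite muleA -EFinM le_eqVlt; apply/orP; left; apply/eqP; congr (_%:E * _)%E; ring.
Qed.

End translate.

(** * Complex-valued square-integrable functions *)

Section complex_l2.
Context {R : realType}.
Local Notation mu := (@lebesgue_measure R).
Local Notation L1 f := (mu.-integrable [set: R] (EFin \o f)).
Local Notation Re := complex.Re.
Local Notation Im := complex.Im.
Implicit Types (f g h : R -> R[i]) (z : R[i]).

Definition nsq z : R := Re z ^+ 2 + Im z ^+ 2.

(** Square of the L^2 norm. Working with squares keeps the estimates polynomial: [nsqD_le] stands in
    for the triangle inequality at the price of constants. *)
Definition N2 f : \bar R := (\int[mu]_x (nsq (f x))%:E)%E.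

Lemma nsq_ge0 z : 0 <= nsq z.
Proof. by rewrite addr_ge0// sqr_ge0. Qed.

Lemma normc_sqr z : Normc.normc z ^+ 2 = nsq z.
Proof. by case: z => a b; rewrite /nsq/= sqr_sqrtr// addr_ge0// sqr_ge0. Qed.

Lemma normc_ge0 z : 0 <= Normc.normc z.
Proof. by case: z => a b; exact: sqrtr_ge0. Qed.

Lemma nsqM z1 z2 : nsq (z1 * z2) = nsq z1 * nsq z2.
Proof. by case: z1 => a b; case: z2 => c d; rewrite /nsq/=; ring. Qed.

Lemma nsqD_le z1 z2 : nsq (z1 + z2) <= 2 * nsq z1 + 2 * nsq z2.
Proof.
case: z1 => a b; case: z2 => c d; rewrite /nsq/=.
have := sqr_ge0 (a - c); have := sqr_ge0 (b - d); nra.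
Qed.

Lemma nsqN z : nsq (- z) = nsq z.
Proof. by case: z => a b; rewrite /nsq/= !sqrrN. Qed.

Lemma measurable_nsq f : cmeasurable f -> measurable_fun [set: R] (fun x => nsq (f x)).
Proof. by move=> [m1 m2]; apply: measurable_funD; exact: measurable_funX. Qed.

Lemma N2_ge0 f : (0 <= N2 f)%E.
Proof. by apply: integral_ge0 => x _; rewrite lee_fin nsq_ge0. Qed.

Lemma cmeasurableD f g : cmeasurable f -> cmeasurable g -> cmeasurable (fun x => f x + g x).
Proof.
move=> [f1 f2] [g1 g2]; split.
  rewrite (_ : (fun x => _) = (fun x => Re (f x) + Re (g x))); first exact: measurable_funD.
  by apply/funext => x; case: (f x) => a b; case: (g x).
rewrite (_ : (fun x => _) = (fun x => Im (f x) + Im (g x))); first exact: measurable_funD.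
by apply/funext => x; case: (f x) => a b; case: (g x).
Qed.

Lemma cmeasurableN f : cmeasurable f -> cmeasurable (fun x => - f x).
Proof.
move=> [f1 f2]; split.
  rewrite (_ : (fun x => _) = (fun x => - Re (f x))); first exact: measurable_funN.
  by apply/funext => x; case: (f x).
rewrite (_ : (fun x => _) = (fun x => - Im (f x))); first exact: measurable_funN.
by apply/funext => x; case: (f x).
Qed.

Lemma cmeasurableB f g : cmeasurable f -> cmeasurable g -> cmeasurable (fun x => f x - g x).
Proof. by move=> mf mg; apply: cmeasurableD => //; exact: cmeasurableN. Qed.

Lemma cmeasurableM f g : cmeasurable f -> cmeasurable g -> cmeasurable (fun x => f x * g x).
Proof.
move=> [f1 f2] [g1 g2]; split.
  rewrite (_ : (fun x => _) = (fun x => Re (f x) * Re (g x) - Im (f x) * Im (g x))).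
    by apply: measurable_funB; exact: measurable_funM.
  by apply/funext => x; case: (f x) => a b; case: (g x).
rewrite (_ : (fun x => _) = (fun x => Re (f x) * Im (g x) + Im (f x) * Re (g x))).
  by apply: measurable_funD; exact: measurable_funM.
by apply/funext => x; case: (f x) => a b; case: (g x).
Qed.

Lemma cmeasurable_addr f t : cmeasurable f -> cmeasurable (fun x => f (x + t)).
Proof.
by move=> [f1 f2]; split; [apply: (measurableT_comp f1)|apply: (measurableT_comp f2)];
  exact: measurable_addr.
Qed.

Lemma le_N2D f g : cmeasurable f -> cmeasurable g ->
  (N2 (fun x => (f x + g x)%R) <= 2%:E * N2 f + 2%:E * N2 g)%E.
Proof.
move=> mf mg; rewrite /N2.
have mf' : measurable_fun [set: R] (fun x => (nsq (f x))%:E).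
  by apply/measurable_EFinP; exact: measurable_nsq.
have mg' : measurable_fun [set: R] (fun x => (nsq (g x))%:E).
  by apply/measurable_EFinP; exact: measurable_nsq.
have f0 x : (0 <= (nsq (f x))%:E)%E by rewrite lee_fin nsq_ge0.
have g0 x : (0 <= (nsq (g x))%:E)%E by rewrite lee_fin nsq_ge0.
rewrite -ge0_integralZl// -[X in (_ <= _ + X)%E]ge0_integralZl// -ge0_integralD//.
- apply: ge0_le_integral => //.
  + by move=> x _; rewrite lee_fin nsq_ge0.
  + by apply/measurable_EFinP; apply: measurable_nsq; exact: cmeasurableD.
  + by apply: emeasurable_funD; exact: emeasurable_funM.
  + by move=> x _; rewrite -!EFinM -EFinD lee_fin nsqD_le.
- by move=> x _; rewrite mule_ge0.
- exact: emeasurable_funM.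
- by move=> x _; rewrite mule_ge0.
- exact: emeasurable_funM.
Qed.

Lemma N2N f : N2 (fun x => - f x) = N2 f.
Proof. by apply: eq_integral => x _; rewrite nsqN. Qed.

Lemma le_N2B f g : cmeasurable f -> cmeasurable g ->
  (N2 (fun x => (f x - g x)%R) <= 2%:E * N2 f + 2%:E * N2 g)%E.
Proof.
by move=> mf mg; rewrite -(N2N g); apply: le_N2D => //; exact: cmeasurableN.
Qed.

Lemma N2_addr f t : cmeasurable f -> N2 (fun x => f (x + t)) = N2 f.
Proof.
move=> mf; rewrite /N2 (@ge0_integral_addr _ t (fun x => (nsq (f x))%:E))//.
  by apply/measurable_EFinP; exact: measurable_nsq.
by move=> x; rewrite lee_fin nsq_ge0.
Qed.

Lemma le_N2M (M : R) f g : cmeasurable f -> cmeasurable g -> (forall x, nsq (f x) <= M) ->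
  (N2 (fun x => (f x * g x)%R) <= M%:E * N2 g)%E.
Proof.
move=> mf mg fM; rewrite /N2.
have M0 : 0 <= M by apply: le_trans (fM 0); exact: nsq_ge0.
have mg' : measurable_fun [set: R] (fun x => (nsq (g x))%:E).
  by apply/measurable_EFinP; exact: measurable_nsq.
rewrite -ge0_integralZl//; last by move=> x _; rewrite lee_fin nsq_ge0.
apply: ge0_le_integral => //.
- by move=> x _; rewrite lee_fin nsq_ge0.
- by apply/measurable_EFinP; apply: measurable_nsq; exact: cmeasurableM.
- exact: emeasurable_funM.
- by move=> x _; rewrite -EFinM lee_fin nsqM ler_wpM2r// nsq_ge0.
Qed.

Lemma N2_split f : cmeasurable f ->
  (N2 f = \int[mu]_x (Re (f x) ^+ 2)%:E + \int[mu]_x (Im (f x) ^+ 2)%:E)%E.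
Proof.
move=> [m1 m2]; rewrite /N2 -ge0_integralD//.
- by move=> x _; rewrite lee_fin sqr_ge0.
- by apply/measurable_EFinP; exact: measurable_funX.
- by move=> x _; rewrite lee_fin sqr_ge0.
- by apply/measurable_EFinP; exact: measurable_funX.
Qed.

Lemma cLnorm2E f : cLnorm 2 f = (N2 f `^ 2^-1)%E.
Proof.
rewrite /cLnorm unlock; congr (_ `^ _)%E; apply: eq_integral => x _.
rewrite abse_EFin ger0_norm ?normc_ge0// poweR_EFin powR_mulrn ?normc_ge0//.
by rewrite normc_sqr.
Qed.

Lemma cLnorm2_lty f : (cLnorm 2 f < +oo)%E <-> (N2 f < +oo)%E.
Proof.
rewrite cLnorm2E; split=> [|]; last exact: poweR_lty.
by apply: lty_poweRy; rewrite invr_neq0.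
Qed.

(** Used with exponents 2 and 1/2, to pass between norms and squared norms. *)
Lemma cvg_poweR0 (u : nat -> \bar R) (p : R) : 0 < p -> (forall n, (0 <= u n)%E) ->
  u @ \oo --> 0%E -> (fun n => u n `^ p)%E @ \oo --> 0%E.
Proof.
move=> p0 u0 /fine_cvgP[finu cvgu]; apply/fine_cvgP; split.
  by apply: filterS finu => n; exact: fin_num_poweR.
apply/cvgr0Pnorm_lt => e e0; near=> n.
rewrite /= fine_poweR ger0_norm ?powR_ge0//.
rewrite [ltRHS](_ : e = (e `^ p^-1) `^ p); last first.
  by rewrite -powRrM mulVf ?gt_eqF// powRr1// ltW.
rewrite gt0_ltr_powR ?nnegrE ?powR_ge0//; first exact: fine_ge0.
apply: le_lt_trans (ler_norm _) _; near: n.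
by move/cvgr0Pnorm_lt : cvgu; apply; exact: powR_gt0.
Unshelve. all: by end_near. Qed.

Lemma cLnorm2_cvg0 (F : nat -> R -> R[i]) :
  (fun n => cLnorm 2 (F n)) @ \oo --> 0%E <-> (fun n => N2 (F n)) @ \oo --> 0%E.
Proof.
split => h.
  have -> : (fun n => N2 (F n)) = (fun n => cLnorm 2 (F n) `^ 2)%E.
    by apply/funext => n; rewrite cLnorm2E -poweRrM mulVf// poweRe1// N2_ge0.
  by apply: cvg_poweR0 => // n; rewrite cLnorm2E poweR_ge0.
have -> : (fun n => cLnorm 2 (F n)) = (fun n => N2 (F n) `^ 2^-1)%E.
  by apply/funext => n; rewrite cLnorm2E.
by apply: cvg_poweR0 => // n; exact: N2_ge0.
Qed.

Lemma in_L2P f : in_L 2 f <-> cmeasurable f /\ (N2 f < +oo)%E.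
Proof. by split=> -[m h]; split => //; exact/cLnorm2_lty. Qed.

Lemma in_L2_Re f : in_L 2 f -> L1 (fun x => Re (f x) ^+ 2).
Proof.
move=> /in_L2P[mf f2]; have [m1 m2] := mf; apply/integrableRP; split; first exact: measurable_funX.
apply: le_lt_trans f2; rewrite (N2_split mf).
under eq_integral do rewrite ger0_norm ?sqr_ge0//.
by rewrite leeDl//; apply: integral_ge0 => x _; rewrite lee_fin sqr_ge0.
Qed.

Lemma in_L2_Im f : in_L 2 f -> L1 (fun x => Im (f x) ^+ 2).
Proof.
move=> /in_L2P[mf f2]; have [m1 m2] := mf; apply/integrableRP; split; first exact: measurable_funX.
apply: le_lt_trans f2; rewrite (N2_split mf).
under eq_integral do rewrite ger0_norm ?sqr_ge0//.
by rewrite leeDr//; apply: integral_ge0 => x _; rewrite lee_fin sqr_ge0.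
Qed.

Lemma cLnorm1E f : cLnorm 1 f = (\int[mu]_x (Normc.normc (f x))%:E)%E.
Proof.
rewrite /cLnorm Lnorm1; apply: eq_integral => x _.
by rewrite abse_EFin ger0_norm ?normc_ge0.
Qed.

Lemma normcE z : Normc.normc z = Num.sqrt (nsq z).
Proof. by case: z. Qed.

Lemma measurable_normc f : cmeasurable f -> measurable_fun [set: R] (fun x => Normc.normc (f x)).
Proof.
move=> mf; rewrite (_ : (fun x => _) = (fun x => nsq (f x) `^ 2^-1)).
  by apply: (measurableT_comp (measurable_powR _)); exact: measurable_nsq.
by apply/funext => x; rewrite normcE powR12_sqrt// nsq_ge0.
Qed.

(** The modulus dominates the real and imaginary parts and is dominated by the sum of their absolute
    values. *)
Lemma in_L1P f : in_L 1 f <-> L1 (fun x => Re (f x)) /\ L1 (fun x => Im (f x)).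
Proof.
split=> [[mf f1]|[/integrableRP[m1 i1] /integrableRP[m2 i2]]].
  have [m1 m2] := mf; rewrite cLnorm1E in f1.
  have mn := measurable_normc mf.
  split; apply/integrableRP; split => //; apply: le_lt_trans f1; apply: ge0_le_integral => //;
    try (by apply/measurable_EFinP; exact: measurableT_comp);
    try (by apply/measurable_EFinP);
    by move=> x _; rewrite lee_fin normcE -sqrtr_sqr ler_wsqrtr// /nsq ?lerDl ?lerDr sqr_ge0.
have mf : cmeasurable f by [].
split => //; rewrite cLnorm1E.
apply: (@le_lt_trans _ _ (\int[mu]_x (`|Re (f x)|%:E + `|Im (f x)|%:E))%E).
  apply: ge0_le_integral => //.
  - by move=> x _; rewrite lee_fin normc_ge0.
  - by apply/measurable_EFinP; exact: measurable_normc.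
  - by apply: emeasurable_funD; apply/measurable_EFinP; exact: measurableT_comp.
  - move=> x _; rewrite -EFinD lee_fin normcE.
    rewrite -[leRHS]ger0_norm ?addr_ge0// -sqrtr_sqr ler_wsqrtr// /nsq.
    rewrite -(real_normK (num_real (Re _))) -(real_normK (num_real (Im _))).
    have := mulr_ge0 (normr_ge0 (Re (f x))) (normr_ge0 (Im (f x))); nra.
rewrite ge0_integralD//.
- exact: lte_add_pinfty.
- by apply/measurable_EFinP; exact: measurableT_comp.
- by apply/measurable_EFinP; exact: measurableT_comp.
Qed.

End complex_l2.

(** * Complex Fourier integrals through cosine and sine transforms *)

Section fourier.
Context {R : realType}.
Local Notation mu := (@lebesgue_measure R).
Local Notation L1 f := (mu.-integrable [set: R] (EFin \o f)).
Local Notation Re := complex.Re.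
Local Notation Im := complex.Im.
Local Notation C f := (oscint cos f).
Local Notation S f := (oscint sin f).
Implicit Types (f g h : R -> R[i]).

Let cC := @continuous_cos R.
Let cS := @continuous_sin R.
Let C1 := @cos_max R.
Let S1 := @sin_max R.

Lemma Re_fourier_L1 f u : in_L 1 f ->
  Re (fourier_L1 f u) = C (fun x => Re (f x)) u - S (fun x => Im (f x)) u.
Proof.
move=> /in_L1P[f1 f2]; rewrite /fourier_L1 /cintegral /= /oscint.
rewrite -RintegralB//; first by apply: eq_Rintegral => x _; case: (f x).
- exact: (integrable_oscint cC C1).
- exact: (integrable_oscint cS S1).
Qed.

Lemma Im_fourier_L1 f u : in_L 1 f ->
  Im (fourier_L1 f u) = C (fun x => Im (f x)) u + S (fun x => Re (f x)) u.
Proof.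
move=> /in_L1P[f1 f2]; rewrite /fourier_L1 /cintegral /= /oscint.
rewrite -RintegralD//; first by apply: eq_Rintegral => x _; case: (f x).
- exact: (integrable_oscint cC C1).
- exact: (integrable_oscint cS S1).
Qed.

Lemma fourier_L1E f u : in_L 1 f -> fourier_L1 f u =
  (C (fun x => Re (f x)) u - S (fun x => Im (f x)) u) +i*
  (C (fun x => Im (f x)) u + S (fun x => Re (f x)) u).
Proof.
by move=> fi; rewrite -(Re_fourier_L1 u fi) -(Im_fourier_L1 u fi); case: (fourier_L1 f u).
Qed.

Lemma cmeasurable_fourier_L1 f : in_L 1 f -> cmeasurable (fourier_L1 f).
Proof.
move=> fi; have [f1 f2] := (in_L1P f).1 fi.
have mc (k : R -> R) : L1 k -> measurable_fun [set: R] (C k).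
  by move=> ki; apply: continuous_measurable_fun; exact: continuous_oscint.
have ms (k : R -> R) : L1 k -> measurable_fun [set: R] (S k).
  by move=> ki; apply: continuous_measurable_fun; exact: continuous_oscint.
split.
  rewrite (_ : (fun u => _) = fun u => C (fun x => Re (f x)) u - S (fun x => Im (f x)) u).
    by apply: measurable_funB; [exact: mc|exact: ms].
  by apply/funext => u; exact: Re_fourier_L1.
rewrite (_ : (fun u => _) = fun u => C (fun x => Im (f x)) u + S (fun x => Re (f x)) u).
  by apply: measurable_funD; [exact: mc|exact: ms].
by apply/funext => u; exact: Im_fourier_L1.
Qed.

Lemma in_L1B f g : in_L 1 f -> in_L 1 g -> in_L 1 (fun x => f x - g x).
Proof.
move=> /in_L1P[f1 f2] /in_L1P[g1 g2]; apply/in_L1P; split.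
  rewrite (_ : (fun x => _) = (fun x => Re (f x) - Re (g x))); first exact: integrableRB.
  by apply/funext => x; case: (f x) => a b; case: (g x).
rewrite (_ : (fun x => _) = (fun x => Im (f x) - Im (g x))); first exact: integrableRB.
by apply/funext => x; case: (f x) => a b; case: (g x).
Qed.

Lemma oscintB (e : R -> R) (f g : R -> R) u : continuous e -> (forall x, `|e x| <= 1) ->
  L1 f -> L1 g -> oscint e (fun x => f x - g x) u = oscint e f u - oscint e g u.
Proof.
move=> ce e1 fi gi; rewrite /oscint -RintegralB//.
- by apply: eq_Rintegral => x _; ring.
- exact: integrable_oscint.
- exact: integrable_oscint.
Qed.

Lemma fourier_L1B f g u : in_L 1 f -> in_L 1 g ->
  fourier_L1 (fun x => f x - g x) u = fourier_L1 f u - fourier_L1 g u.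
Proof.
move=> fi gi; have [f1 f2] := (in_L1P f).1 fi; have [g1 g2] := (in_L1P g).1 gi.
rewrite !fourier_L1E//; last exact: in_L1B.
have -> : (fun x => Re (f x - g x)) = (fun x => Re (f x) - Re (g x)).
  by apply/funext => x; case: (f x) => a b; case: (g x).
have -> : (fun x => Im (f x - g x)) = (fun x => Im (f x) - Im (g x)).
  by apply/funext => x; case: (f x) => a b; case: (g x).
rewrite !oscintB//.
by apply/eqP; rewrite eq_complex/=; apply/andP; split; apply/eqP; ring.
Qed.

Lemma in_L1_addr f t : in_L 1 f -> in_L 1 (fun x => f (x + t)).
Proof.
move=> /in_L1P[f1 f2]; apply/in_L1P; split.
  exact: (integrable_addr t f1).
exact: (integrable_addr t f2).
Qed.

(** It is the integral on the right that is translated by [t]; the addition formulas then leave the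
    factor [cos (u * t) ^+ 2 + sin (u * t) ^+ 2], which is 1. *)
Lemma cos_oscint_addr (f : R -> R) t u : L1 f ->
  C (fun x => f (x + t)) u = cos (u * t) * C f u + sin (u * t) * S f u.
Proof.
move=> fi; have i1 := integrable_oscint cC C1 u fi; have i2 := integrable_oscint cS S1 u fi.
have j1 : L1 (fun x => cos (u * t) * (cos (u * x) * f x)) by exact: (integrableZl _ (cos (u * t)) i1).
have j2 : L1 (fun x => sin (u * t) * (sin (u * x) * f x)) by exact: (integrableZl _ (sin (u * t)) i2).
rewrite /oscint -(RintegralZl (cos (u * t)) measurableT i1).
rewrite -(RintegralZl (sin (u * t)) measurableT i2) -(RintegralD measurableT j1 j2).
rewrite -(Rintegral_addr t (integrableRD j1 j2)); apply: eq_Rintegral => x _.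
rewrite (_ : u * (x + t) = u * x + u * t) ?cosD ?sinD; last by ring.
have : cos (u * t) ^+ 2 + sin (u * t) ^+ 2 = 1 by exact: cos2Dsin2.
set a := cos (u * t); set b := sin (u * t); set c := cos _; set s := sin _ => ab.
have -> : a * ((c * a - s * b) * f (x + t)) + b * ((s * a + c * b) * f (x + t)) =
  (a ^+ 2 + b ^+ 2) * (c * f (x + t)) by ring.
by rewrite ab mul1r.
Qed.

Lemma sin_oscint_addr (f : R -> R) t u : L1 f ->
  S (fun x => f (x + t)) u = cos (u * t) * S f u - sin (u * t) * C f u.
Proof.
move=> fi; have i1 := integrable_oscint cS S1 u fi; have i2 := integrable_oscint cC C1 u fi.
have j1 : L1 (fun x => cos (u * t) * (sin (u * x) * f x)) by exact: (integrableZl _ (cos (u * t)) i1).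
have j2 : L1 (fun x => sin (u * t) * (cos (u * x) * f x)) by exact: (integrableZl _ (sin (u * t)) i2).
rewrite /oscint -(RintegralZl (cos (u * t)) measurableT i1).
rewrite -(RintegralZl (sin (u * t)) measurableT i2) -(RintegralB measurableT j1 j2).
rewrite -(Rintegral_addr t (integrableRB j1 j2)); apply: eq_Rintegral => x _.
rewrite (_ : u * (x + t) = u * x + u * t) ?cosD ?sinD; last by ring.
have : cos (u * t) ^+ 2 + sin (u * t) ^+ 2 = 1 by exact: cos2Dsin2.
set a := cos (u * t); set b := sin (u * t); set c := cos _; set s := sin _ => ab.
have -> : a * ((s * a + c * b) * f (x + t)) - b * ((c * a - s * b) * f (x + t)) =
  (a ^+ 2 + b ^+ 2) * (s * f (x + t)) by ring.
by rewrite ab mul1r.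
Qed.

Lemma fourier_L1_addr f t u : in_L 1 f ->
  fourier_L1 (fun x => f (x + t)) u = cexpi (- (u * t)) * fourier_L1 f u.
Proof.
move=> fi; have [f1 f2] := (in_L1P f).1 fi.
rewrite !fourier_L1E//; last exact: in_L1_addr.
have e1 := cos_oscint_addr t u f1; have e2 := cos_oscint_addr t u f2.
have e3 := sin_oscint_addr t u f1; have e4 := sin_oscint_addr t u f2.
rewrite e1 e2 e3 e4 /cexpi cosN sinN.
by apply/eqP; rewrite eq_complex/=; apply/andP; split; apply/eqP; ring.
Qed.

(** The real and imaginary parts of the transform mix the transforms of [Re f] and [Im f]. Absorbing
    the cross terms by [2xy <= x^2 + y^2] doubles the constant [20 * pi] of the real case. *)
Lemma plancherel_N2_le f : in_L 1 f -> (N2 (fourier_L1 f) <= (40 * pi)%:E * N2 f)%E.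
Proof.
move=> fi; have [f1 f2] := (in_L1P f).1 fi; have mf := fi.1; have [m1 m2] := mf.
have K0 : (0 <= (40 * pi : R)%:E)%E by rewrite lee_fin mulr_ge0// pi_ge0.
pose P (k : R -> R) u := C k u ^+ 2 + S k u ^+ 2.
have mP (k : R -> R) : L1 k -> measurable_fun [set: R] (fun u => (2 * P k u)%:E).
  move=> ki; apply/measurable_EFinP; apply: measurable_funM => //.
  by apply: measurable_funD; apply: measurable_funX; apply: continuous_measurable_fun;
    exact: continuous_oscint.
have P0 (k : R -> R) u : (0 <= (2 * P k u)%:E)%E.
  by rewrite lee_fin mulr_ge0// addr_ge0// sqr_ge0.
have le2 (k : R -> R) : L1 k ->
    (\int[mu]_u (2 * P k u)%:E <= (40 * pi)%:E * \int[mu]_x (k x ^+ 2)%:E)%E.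
  move=> ki.
  have -> : (40 * pi)%:E = (2%:E * (20 * pi)%:E)%E :> \bar R.
    by rewrite -EFinM; congr EFin; ring.
  under eq_integral do rewrite EFinM.
  rewrite ge0_integralZl//; last 2 first.
  - apply/measurable_EFinP; apply: measurable_funD; apply: measurable_funX;
      apply: continuous_measurable_fun; exact: continuous_oscint.
  - by move=> u _; rewrite lee_fin addr_ge0// sqr_ge0.
  by rewrite -muleA lee_wpmul2l ?lee_fin//; exact: plancherel_le.
rewrite (N2_split mf) ge0_muleDr; last 2 first.
- by apply: integral_ge0 => x _; rewrite lee_fin sqr_ge0.
- by apply: integral_ge0 => x _; rewrite lee_fin sqr_ge0.
apply: le_trans (leeD (le2 _ f1) (le2 _ f2)).
rewrite -ge0_integralD//; last 2 first.
- exact: mP.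
- exact: mP.
apply: ge0_le_integral => //.
- by move=> u _; rewrite lee_fin nsq_ge0.
- by apply/measurable_EFinP; apply: measurable_nsq; exact: cmeasurable_fourier_L1.
- by apply: emeasurable_funD; exact: mP.
- move=> u _; rewrite -EFinD lee_fin fourier_L1E// /nsq/= /P.
  set a := C _ u; set b := S _ u; set c := C _ u; set d := S _ u.
  have := sqr_ge0 (a + b); have := sqr_ge0 (c - d); nra.
Qed.

End fourier.

(** * Decay of the Fourier transform *)

Section decay.
Context {R : realType}.
Local Notation mu := (@lebesgue_measure R).
Local Notation L1 f := (mu.-integrable [set: R] (EFin \o f)).
Local Notation Re := complex.Re.
Local Notation Im := complex.Im.
Implicit Types (f g h w : R -> R[i]).

(** Test functions are real, so the identity defining [w] splits into one for real parts and one for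
    imaginary parts. *)
Lemma N2_translate_le g w (t : R) : 0 < t -> in_L 2 g -> in_L 2 w -> weak_derivative g w ->
  (N2 (fun x => (g (x + t) - g x)%R) <= (4 * t ^+ 2)%:E * N2 w)%E.
Proof.
move=> t0 g2 w2 gw; have [mg _] := g2; have [mw _] := w2.
have [mg1 mg2] := mg; have [mw1 mw2] := mw.
have mgt : cmeasurable (fun x => g (x + t) - g x).
  by apply: cmeasurableB => //; exact: cmeasurable_addr.
have ReC (k : R -> R[i]) (p : R -> R) x : Re (k x * (p x)%:C) = Re (k x) * p x.
  by case: (k x) => a b /=; ring.
have ImC (k : R -> R[i]) (p : R -> R) x : Im (k x * (p x)%:C) = Im (k x) * p x.
  by case: (k x) => a b /=; ring.
rewrite (N2_split mgt) (N2_split mw) ge0_muleDr; last 2 first.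
- by apply: integral_ge0 => x _; rewrite lee_fin sqr_ge0.
- by apply: integral_ge0 => x _; rewrite lee_fin sqr_ge0.
apply: leeD.
  have -> : (\int[mu]_x (Re (g (x + t)%R - g x) ^+ 2)%:E =
      \int[mu]_x ((Re (g (x + t)%R) - Re (g x)) ^+ 2)%:E)%E.
    by apply: eq_integral => x _; case: (g x) => a b; case: (g (x + t)).
  apply: (@weak_derivative_translate_le _ (fun x => Re (g x)) (fun x => Re (w x))) => //.
  - exact: in_L2_Re.
  - exact: in_L2_Re.
  - move=> phi /gw /(congr1 (@complex.Re R)) /=.
    under eq_Rintegral do rewrite ReC.
    by move=> ->; congr (- _); apply: eq_Rintegral => x _; rewrite ReC.
have -> : (\int[mu]_x (Im (g (x + t)%R - g x) ^+ 2)%:E =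
    \int[mu]_x ((Im (g (x + t)%R) - Im (g x)) ^+ 2)%:E)%E.
  by apply: eq_integral => x _; case: (g x) => a b; case: (g (x + t)).
apply: (@weak_derivative_translate_le _ (fun x => Im (g x)) (fun x => Im (w x))) => //.
- exact: in_L2_Im.
- exact: in_L2_Im.
- move=> phi /gw /(congr1 (@complex.Im R)) /=.
  under eq_Rintegral do rewrite ImC.
  by move=> ->; congr (- _); apply: eq_Rintegral => x _; rewrite ImC.
Qed.

Let E (t u : R) : R[i] := cexpi (- (u * t)) - 1.

Lemma cmeasurable_phase t : cmeasurable (E t).
Proof.
have mu' : measurable_fun [set: R] (fun u : R => - (u * t)).
  by apply: measurable_funN; exact: measurable_funM.
split.
  rewrite (_ : (fun u => _) = (fun u => cos (- (u * t)) - 1)).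
    apply: measurable_funB => //.
    by apply: (measurableT_comp (continuous_measurable_fun (@continuous_cos R))).
  by apply/funext.
rewrite (_ : (fun u => _) = (fun u => sin (- (u * t)))).
  by apply: (measurableT_comp (continuous_measurable_fun (@continuous_sin R))).
by apply/funext => u; rewrite /E /cexpi /= subr0.
Qed.

Lemma nsq_phase_le t u : nsq (E t u) <= 4.
Proof.
have := cos2Dsin2 (- (u * t)); have := cos_max (- (u * t)).
by rewrite /nsq /E /cexpi/= subr0 ler_norml => /andP[c1 c2]; nra.
Qed.

(** [h] is only a limit of Fourier integrals, so [E t * h] is split as [E t * (h - F)] plus
    [E t * F], with [F] the transform of [f n]. The second term is the transform of
    [f n (x + t) - f n x], compared in turn with the difference of [g]. The constants are 8 = 2 * 4,
    640 = 2 * 40 * 8 and 160 = 2 * 40 * 2 in [bound], then 640 = 160 * 4 in the conclusion. *)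
Lemma N2_phaseM_le g h w (t : R) : 0 < t -> in_L 2 g -> in_L 2 w -> weak_derivative g w ->
  fourier_L2 g h ->
  (N2 (fun u => (E t u * h u)%R) <= (640 * pi * t ^+ 2)%:E * N2 w)%E.
Proof.
move=> t0 g2 w2 gw [h2 [f [fi /cLnorm2_cvg0 fg /cLnorm2_cvg0 fh]]].
have [mg _] := g2; have [mh _] := h2; have mE := cmeasurable_phase t.
have K0 : (0 <= (40 * pi : R)%:E)%E by rewrite lee_fin mulr_ge0// pi_ge0.
set D := N2 (fun x => (g (x + t) - g x)%R).
have bound n : (N2 (fun u => (E t u * h u)%R) <=
    8%:E * N2 (fun u => (fourier_L1 (f n) u - h u)%R) +
    (640 * pi)%:E * N2 (fun x => (f n x - g x)%R) + (160 * pi)%:E * D)%E.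
  have [fi1 fi2] := fi n; have [mf _] := fi2.
  have mF := cmeasurable_fourier_L1 fi1.
  have mft := cmeasurable_addr t mf; have mgt := cmeasurable_addr t mg.
  have mEF : cmeasurable (fun u => E t u * (h u - fourier_L1 (f n) u)).
    by apply: cmeasurableM => //; exact: cmeasurableB.
  have mEF' : cmeasurable (fun u => E t u * fourier_L1 (f n) u) by exact: cmeasurableM.
  have -> : N2 (fun u => (E t u * h u)%R) = N2 (fun u => (E t u * (h u - fourier_L1 (f n) u) +
      E t u * fourier_L1 (f n) u)%R).
    by apply: eq_integral => u _; congr ((nsq _)%:E); ring.
  apply: le_trans (le_N2D mEF mEF') _.
  rewrite -addeA; apply: leeD.
    have -> : 8%:E = (2%:E * 4%:E)%E :> \bar R by rewrite -EFinM; congr EFin; ring.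
    rewrite -muleA lee_wpmul2l ?lee_fin//.
    apply: le_trans (le_N2M mE _ (nsq_phase_le t)) _; first exact: cmeasurableB.
    rewrite -N2N lee_wpmul2l ?lee_fin//.
    by rewrite le_eqVlt; apply/orP; left; apply/eqP; apply: eq_integral => u _; rewrite opprB.
  have eF : (fun u => E t u * fourier_L1 (f n) u) = fourier_L1 (fun x => f n (x + t) - f n x).
    apply/funext => u; rewrite fourier_L1B//; last exact: in_L1_addr.
    by rewrite fourier_L1_addr// /E; ring.
  rewrite eF.
  have i1 : in_L 1 (fun x => f n (x + t) - f n x) by apply: in_L1B => //; exact: in_L1_addr.
  have le1 : (N2 (fun x => (f n (x + t) - f n x)%R) <=
      8%:E * N2 (fun x => (f n x - g x)%R) + 2%:E * D)%E.
    have md : cmeasurable (fun x => f n x - g x) by exact: cmeasurableB.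
    have mdt := cmeasurable_addr t md.
    have -> : N2 (fun x => (f n (x + t) - f n x)%R) =
       N2 (fun x => (((f n (x + t) - g (x + t)) - (f n x - g x)) + (g (x + t) - g x))%R).
      by apply: eq_integral => x _; congr ((nsq _)%:E); ring.
    have mdd := cmeasurableB mdt md; have mgg := cmeasurableB mgt mg.
    apply: le_trans (le_N2D mdd mgg) _; rewrite leeD2r//.
    have -> : 8%:E = (2%:E * 4%:E)%E :> \bar R by rewrite -EFinM; congr EFin; ring.
    rewrite -muleA lee_wpmul2l ?lee_fin//.
    apply: le_trans (le_N2B mdt md) _.
    rewrite (N2_addr t md) -ge0_muleDl ?lee_fin//.
    by rewrite -EFinD lee_wpmul2r ?N2_ge0// lee_fin; lra.
  apply: (@le_trans _ _ (2%:E * ((40 * pi)%:E * (8%:E * N2 (fun x => (f n x - g x)%R) + 2%:E * D)))%E).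
    rewrite lee_wpmul2l ?lee_fin//; apply: le_trans (plancherel_N2_le i1) _.
    exact: lee_wpmul2l.
  rewrite muleA ge0_muleDr; last 2 first.
  - by rewrite mule_ge0// ?lee_fin ?N2_ge0.
  - by rewrite mule_ge0// ?lee_fin ?N2_ge0.
  rewrite !muleA -!EFinM le_eqVlt; apply/orP; left; apply/eqP.
  by congr (_%:E * _ + _%:E * _)%E; ring.
apply: (@le_trans _ _ ((160 * pi)%:E * D)%E); last first.
  have -> : (640 * pi * t ^+ 2)%:E = ((160 * pi)%:E * (4 * t ^+ 2)%:E)%E :> \bar R.
    by rewrite -EFinM; congr EFin; ring.
  rewrite -muleA lee_wpmul2l//; first by rewrite lee_fin mulr_ge0// pi_ge0.
  exact: N2_translate_le.
(* Finiteness of [D] makes the sum of limits well defined in the extended reals; the two terms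
   depending on [n] then tend to 0. *)
have Dfin : (D < +oo)%E.
  apply: le_lt_trans (N2_translate_le t0 g2 w2 gw) _.
  apply: lte_mul_pinfty => //; last by have [] := (in_L2P w).1 w2.
  by rewrite lee_fin mulr_ge0// sqr_ge0.
have KD : ((160 * pi)%:E * D)%E \is a fin_num.
  by rewrite fin_numM// ge0_fin_numE// N2_ge0.
have cv : (8%:E * N2 (fun u => (fourier_L1 (f n) u - h u)%R) +
    (640 * pi)%:E * N2 (fun x => (f n x - g x)%R) + (160 * pi)%:E * D)%E @[n --> \oo]
    --> (8%:E * 0 + (640 * pi)%:E * 0 + (160 * pi)%:E * D)%E.
  apply: cvgeD; last exact: cvg_cst.
    by rewrite !mule0 adde0 fin_num_adde_defl.
  apply: cvgeD; first by rewrite !mule0.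
    by apply: cvgeZl.
  by apply: cvgeZl.
rewrite !mule0 !add0e in cv.
by apply: (cvge_ge _ cv); apply: nearW => n; exact: bound.
Qed.

(** Only the imaginary part [sin (u * t)] is kept. By the mean value theorem [sin v = cos c * v]
    with [c] between 0 and [v], and [cos c >= cos 1 > 0] when [0 <= v <= 1]; oddness handles
    negative arguments. *)
Lemma nsq_phase_ge t u : `|u * t| <= 1 -> cos (1 : R) ^+ 2 * (u * t) ^+ 2 <= nsq (E t u).
Proof.
move=> ut1; rewrite /nsq /E /cexpi/= subr0 sinN sqrrN.
suff : cos (1 : R) ^+ 2 * (u * t) ^+ 2 <= sin (u * t) ^+ 2.
  by move=> h; apply: (le_trans h); rewrite lerDr sqr_ge0.
have pos (v : R) : 0 <= v <= 1 -> cos (1 : R) ^+ 2 * v ^+ 2 <= sin v ^+ 2.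
  move=> /andP[v0 v1].
  have [c c01] := @MVT_segment R sin cos 0 v v0 (fun x _ => is_derive_sin x)
    (continuous_subspaceT (@continuous_sin R)).
  rewrite sin0 !subr0 => ->; rewrite exprMn ler_wpM2r ?sqr_ge0//.
  move: c01; rewrite in_itv/= => /andP[c0 cv].
  have pi1 : 1 <= pi :> R by have := pi_ge2 R; lra.
  have cc : cos 1 <= cos c.
    have : c <= 1 by exact: le_trans cv v1.
    rewrite le_eqVlt => /orP[/eqP->//|c1]; apply/ltW; rewrite ltr_cos// in_itv/=.
      by rewrite c0 (ltW (lt_le_trans c1 pi1)).
    by rewrite pi1 ler01.
  by rewrite lerXn2r// nnegrE; have := cos1_gt0 R; lra.
have [ut0|ut0] := leP 0 (u * t).
  by apply: pos; rewrite ut0/=; move: ut1; rewrite ger0_norm.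
rewrite -(sqrrN (u * t)) -(sqrrN (sin (u * t))) -sinN; apply: pos.
by move: ut1; rewrite ltr0_norm// => ->; rewrite andbT oppr_ge0 ltW.
Qed.

Lemma fourier_L2_in_L1 g h : in_H1 g -> fourier_L2 g h -> in_L 1 h.
Proof.
move=> [g2 [w [gw w2]]] gh; have [h2 _] := gh; have [mh h2fin] := (in_L2P h).1 h2.
have mn := measurable_nsq mh.
(* Ratio of the constants in [N2_phaseM_le] and [nsq_phase_ge]. Both bounds carry [t ^+ 2], which
   cancels, so [A] does not depend on the interval. *)
set A := ((cos (1 : R) ^+ 2)^-1 * (640 * pi))%:E.
have k0 : 0 < cos (1 : R) ^+ 2 by rewrite exprn_gt0// cos1_gt0.
have A0 : (0 <= A)%E.
  rewrite lee_fin; apply: mulr_ge0; first by rewrite invr_ge0 ltW.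
  by apply: mulr_ge0; [exact: ler0n|exact: pi_ge0].
have mu2 : measurable_fun [set: R] (fun u => (u ^+ 2 * nsq (h u))%:E).
  by apply/measurable_EFinP; apply: measurable_funM => //; exact: measurable_funX.
have u20 u : (0 <= (u ^+ 2 * nsq (h u))%:E)%E by rewrite lee_fin mulr_ge0// ?sqr_ge0 ?nsq_ge0.
have moment : (\int[mu]_u (u ^+ 2 * nsq (h u))%:E <= A * N2 w)%E.
  (* The interval for [n = 0] is a null set; otherwise [t] is the inverse of its half-length, so
     that [|u * t| <= 1] on it. *)
  apply: ge0_integral_le_itv => // -[|n].
    rewrite mulr0n oppr0 set_itv1 integral_set1.
    exact: mule_ge0 A0 (N2_ge0 w).
  set t : R := n.+1%:R^-1; have t0 : 0 < t by rewrite invr_gt0 ltr0n.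
  have b := N2_phaseM_le t0 g2 w2 gw gh.
  have mEh : measurable_fun [set: R] (fun u => nsq (E t u * h u)).
    by apply: measurable_nsq; apply: cmeasurableM => //; exact: cmeasurable_phase.
  have c0 : 0 <= (cos (1 : R) ^+ 2 * t ^+ 2)^-1.
    by rewrite invr_ge0 mulr_ge0// ?sqr_ge0.
  apply: (@le_trans _ _ ((cos (1 : R) ^+ 2 * t ^+ 2)^-1%:E * N2 (fun u => (E t u * h u)%R))%E); last first.
    apply: (@le_trans _ _ ((cos (1 : R) ^+ 2 * t ^+ 2)^-1%:E * ((640 * pi * t ^+ 2)%:E * N2 w))%E).
      by rewrite lee_wpmul2l.
    rewrite muleA -EFinM le_eqVlt; apply/orP; left; apply/eqP; congr (_%:E * _)%E.
    by field; rewrite (gt_eqF t0) gt_eqF// cos1_gt0.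
  rewrite /N2 -ge0_integralZl//; last 2 first.
  - exact/measurable_EFinP.
  - by move=> u _; rewrite lee_fin nsq_ge0.
  apply: (@le_trans _ _ (\int[mu]_(u in `[(- n.+1%:R)%R, n.+1%:R%R])
     ((cos (1 : R) ^+ 2 * t ^+ 2)^-1%:E * (nsq (E t u * h u))%:E))%E); last first.
    apply: ge0_subset_integral => //.
      by apply: emeasurable_funM => //; exact/measurable_EFinP.
    by move=> u _; rewrite mule_ge0// lee_fin nsq_ge0.
  apply: ge0_le_integral => //.
  - exact: measurable_funTS.
  - by apply: measurable_funTS; apply: emeasurable_funM => //; exact/measurable_EFinP.
  - move=> u; rewrite /= in_itv/= => un; rewrite -EFinM lee_fin.
    rewrite ler_pdivlMl; last by rewrite mulr_gt0// exprn_gt0.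
    rewrite nsqM mulrA ler_wpM2r ?nsq_ge0//.
    have -> : cos (1 : R) ^+ 2 * t ^+ 2 * u ^+ 2 = cos (1 : R) ^+ 2 * (u * t) ^+ 2 by ring.
    apply: nsq_phase_ge.
    by rewrite normrM (gtr0_norm t0) /t ler_pdivrMr ?ltr0n// mul1r ler_norml.
split => //; rewrite cLnorm1E.
have mk : measurable_fun [set: R] (fun u : R => (cauchy_kernel 1 u)%:E).
  by apply/measurable_EFinP; apply: continuous_measurable_fun; exact: continuous_cauchy_kernel.
have mn' : measurable_fun [set: R] (fun u => (nsq (h u))%:E) by exact/measurable_EFinP.
have n0 u : (0 <= (nsq (h u))%:E)%E by rewrite lee_fin nsq_ge0.
have ck0 u : (0 <= (cauchy_kernel 1 u : R)%:E)%E by rewrite lee_fin cauchy_kernel_ge0.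
apply: (@le_lt_trans _ _ (\int[mu]_u ((nsq (h u))%:E + (u ^+ 2 * nsq (h u))%:E + (cauchy_kernel 1 u)%:E))%E).
  apply: ge0_le_integral => //.
  - by move=> u _; rewrite lee_fin normc_ge0.
  - by apply/measurable_EFinP; exact: measurable_normc.
  - by apply: emeasurable_funD => //; exact: emeasurable_funD.
  (* After multiplication by [d = 1 + u ^+ 2] the claim is [y <= y^2 + 1] for [y = d * a]. *)
  - move=> u _; rewrite -!EFinD lee_fin -normc_sqr /cauchy_kernel !mul1r.
    set a := Normc.normc _; have : 0 < 1 + u ^+ 2 by rewrite ltr_pwDl// sqr_ge0.
    set d := 1 + u ^+ 2 => d0.
    have -> : a ^+ 2 + u ^+ 2 * a ^+ 2 = d * a ^+ 2 by rewrite /d; ring.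
    rewrite -(ler_pM2l d0) mulrDr divff ?gt_eqF//.
    have : 0 <= a by exact: normc_ge0.
    have := sqr_ge0 (d * a - 1); nra.
rewrite ge0_integralD//; last 2 first.
- by move=> u _; exact: adde_ge0.
- exact: emeasurable_funD.
rewrite ge0_integralD// integral_cauchy_kernel//.
rewrite lte_add_pinfty// ?ltry// lte_add_pinfty//.
apply: le_lt_trans moment _.
apply: lte_mul_pinfty => //; last by have [] := (in_L2P w).1 w2.
Qed.

End decay.

(** * Existence of the Fourier transform on L^2 *)

Section existence.
Context {R : realType}.
Local Notation mu := (@lebesgue_measure R).
Local Notation L1 f := (mu.-integrable [set: R] (EFin \o f)).
Local Notation Re := complex.Re.
Local Notation Im := complex.Im.
Implicit Types (f g h w : R -> R[i]).

(** The tail of the geometric series bounds [|a n - a k|] for [n >= k], and the bound passes to the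
    limit in [n]. *)
Lemma cvg_geometric_steps (a : nat -> R) (q : R) : 0 <= q ->
  (forall k, `|a k.+1 - a k| <= 2^-1 ^+ k * q) ->
  exists2 l, a @ \oo --> l & forall k, `|l - a k| <= 2 * (2^-1 ^+ k * q).
Proof.
move=> q0 aq.
have half0 k : 0 <= (2^-1 : R) ^+ k * q by rewrite mulr_ge0// exprn_ge0.
have step k n : `|a (k + n)%N - a k| <= 2 * (2^-1 ^+ k * q) - 2 * (2^-1 ^+ (k + n) * q).
  elim: n => [|n IHn]; first by rewrite addn0 !subrr normr0.
  have -> : a (k + n.+1)%N - a k = (a (k + n).+1 - a (k + n)%N) + (a (k + n)%N - a k).
    by rewrite addnS; ring.
  apply: le_trans (ler_normD _ _) _.
  have := aq (k + n)%N; rewrite addnS exprS; lra.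
have d k n : (k <= n)%N -> `|a n - a k| <= 2 * (2^-1 ^+ k * q).
  move=> kn; have := step k (n - k)%N; rewrite subnKC//.
  by have := half0 n; lra.
have half_cvg : (fun k => 2 * ((2^-1 : R) ^+ k * q)) @ \oo --> (0 : R).
  have -> : (fun k => 2 * ((2^-1 : R) ^+ k * q)) = geometric (2 * q) 2^-1.
    by apply/funext => k /=; ring.
  by apply: cvg_geometric; rewrite ger0_norm ?invr_ge0//; lra.
have ca : cvgn a.
  (* Convergence comes from monotonicity: the added term decreases by exactly [2^-1 ^+ k * q] at
     step [k], at least as much as [a] can increase. *)
  pose b k := a k + 2 * (2^-1 ^+ k * q).
  have cb : cvgn b.
    apply: nonincreasing_is_cvgn.
      apply/nonincreasing_seqP => k; rewrite /b exprS.
      by have := aq k; rewrite ler_norml => /andP[_]; lra.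
    exists (a 0%N - 2 * q) => _ [k _ <-]; rewrite /b.
    have := d 0%N k (leq0n k); rewrite expr0 mul1r ler_norml => /andP[h _].
    by have := half0 k; lra.
  have -> : a = (fun k => b k - 2 * (2^-1 ^+ k * q)) by apply/funext => k; rewrite /b addrK.
  by apply: is_cvgB => //; apply: cvgP half_cvg.
exists (limn a) => // k.
have : `|a n - a k| @[n --> \oo] --> `|limn a - a k|.
  by apply: cvg_norm; apply: cvgB => //; exact: cvg_cst.
move/cvgr_to_le; apply; near=> n; apply: d; near: n; exact: nbhs_infty_ge.
Unshelve. all: by end_near. Qed.

(** The rate [8^-1 ^+ k] leaves room for a weight [4 ^+ k]: the weighted squares still sum to an
    integral of at most [2 * M]. Taking the weight back yields a pointwise bound of
    [nsq (F k u - h u)] by [4^-1 ^+ k] times one integrable function, and integrating it gives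
    convergence with a rate. *)
Lemma riesz_fischer_N2 (F : nat -> R -> R[i]) (M : R) : 0 <= M ->
  (forall k, cmeasurable (F k)) ->
  (forall k, (N2 (fun u => (F k.+1 u - F k u)%R) <= (M * 8^-1 ^+ k)%:E)%E) ->
  exists h, cmeasurable h /\ (fun k => N2 (fun u => (F k u - h u)%R)) @ \oo --> 0%E.
Proof.
move=> M0 mF FM.
pose d k u := nsq (F k.+1 u - F k u).
have d0 k u : 0 <= d k u by exact: nsq_ge0.
have md k : measurable_fun [set: R] (d k).
  by apply: measurable_nsq; exact: cmeasurableB.
pose s k u : \bar R := (4 ^+ k * d k u)%:E.
have s0 k u : (0 <= s k u)%E by rewrite lee_fin mulr_ge0// exprn_ge0.
have ms k : measurable_fun [set: R] (s k).
  by apply/measurable_EFinP; exact: measurable_funM.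
(* Where [S u] is finite, the weights [4 ^+ k] give [|F k.+1 u - F k u| <= 2^-k sqrt (S u)]. *)
pose S u : \bar R := (\sum_(k <oo) s k u)%E.
have mS : measurable_fun [set: R] S.
  by apply: ge0_emeasurable_sum => // k u _ _; exact: s0.
have S0 u : (0 <= S u)%E by apply: nneseries_ge0 => k _ _; exact: s0.
have intS : (\int[mu]_u S u <= (2 * M)%:E)%E.
  rewrite integral_nneseries//.
  apply: (@le_trans _ _ (\sum_(k <oo) (M * 2^-1 ^+ k)%:E)%E).
    apply: lee_nneseries => [k _ _|k _].
      by apply: integral_ge0 => u _; exact: s0.
    rewrite /s; under eq_integral do rewrite EFinM.
    rewrite ge0_integralZl//; last 2 first.
    - by apply/measurable_EFinP; exact: md.
    - by move=> u _; rewrite lee_fin; exact: d0.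
    apply: (@le_trans _ _ ((4 ^+ k)%:E * (M * 8^-1 ^+ k)%:E)%E).
      by rewrite lee_wpmul2l ?lee_fin ?exprn_ge0//; exact: FM.
    rewrite -EFinM lee_fin mulrCA -exprMn.
    by rewrite (_ : 4 * 8^-1 = 2^-1 :> R)//; field.
  have cvM : eseries (fun k => (M * 2^-1 ^+ k)%:E) @ \oo --> (M * (1 - 2^-1)^-1)%:E.
    have cv : series (geometric M 2^-1) @ \oo --> M * (1 - 2^-1)^-1.
      by apply: cvg_geometric_series; rewrite ger0_norm ?invr_ge0//; lra.
    apply: cvg_EFin; first by apply: nearW => n; rewrite /eseries/= sumEFin.
    apply: cvg_trans cv; apply: near_eq_cvg; apply: nearW => n.
    by rewrite /eseries/= sumEFin.
  rewrite (cvg_lim _ cvM)// lee_fin.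
  rewrite (_ : M * (1 - 2^-1)^-1 = 2 * M)//; field.
  by lra.
(* The upper limit is measurable everywhere and is the limit where [S] is finite. *)
pose lre u := fine (limn_esup (fun k => (Re (F k u))%:E)).
pose lim u := fine (limn_esup (fun k => (Im (F k u))%:E)).
pose h u : R[i] := lre u +i* lim u.
have mlim (a : nat -> R -> R) : (forall k, measurable_fun [set: R] (a k)) ->
    measurable_fun [set: R] (fun u => fine (limn_esup (fun k => (a k u)%:E))).
  move=> ma; apply: (@measurableT_comp _ _ _ _ _ _ fine) => //.
  apply: (@measurable_fun_limn_esup _ _ _ setT (fun k u => (a k u)%:E)) => k.
  by apply/measurable_EFinP; exact: ma.
have mh : cmeasurable h.
  split; first by apply: (mlim (fun k u => Re (F k u))) => k; have [] := mF k.
  by apply: (mlim (fun k u => Im (F k u))) => k; have [] := mF k.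
(* The real and imaginary parts are each off by at most [2 * (2^-1 ^+ k * q)] with [q ^+ 2] equal to
   [S u]; two squares of this give the factor 8. *)
have good u : (S u < +oo)%E -> forall k, ((nsq (F k u - h u))%:E <= (8 * 4^-1 ^+ k)%:E * S u)%E.
  move=> Soo; have Sfin : S u \is a fin_num by rewrite ge0_fin_numE.
  pose q := Num.sqrt (fine (S u)).
  have q0 : 0 <= q by exact: sqrtr_ge0.
  have q2 : q ^+ 2 = fine (S u) by rewrite sqr_sqrtr// fine_ge0.
  have dq k : d k u <= (2^-1 ^+ k * q) ^+ 2.
    have : (s k u <= S u)%E.
      apply: le_trans (nneseries_lim_ge k.+1 _) => [|n _ _]; last exact: s0.
      by rewrite big_nat_recr//= leeDr// sume_ge0.
    rewrite -{1}(fineK Sfin) lee_fin -q2 => h1.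
    rewrite exprMn -exprM mulnC exprM -(ler_pM2l (_ : 0 < 4 ^+ k)) ?exprn_gt0//.
    apply: (le_trans h1); rewrite mulrA -exprMn.
    by rewrite (_ : 4 * 2^-1 ^+ 2 = 1 :> R) ?expr1n ?mul1r//; field.
  have half0 k : 0 <= (2^-1 : R) ^+ k * q by rewrite mulr_ge0// exprn_ge0.
  (* [p] stands for either of the two coordinates. *)
  have part (p : R[i] -> R) : (forall z, p z ^+ 2 <= nsq z) ->
      (forall z1 z2, p (z1 - z2) = p z1 - p z2) ->
      forall k, `|fine (limn_esup (fun k => (p (F k u))%:E)) - p (F k u)| <= 2 * (2^-1 ^+ k * q).
    move=> pn pB.
    have pq k : `|p (F k.+1 u) - p (F k u)| <= 2^-1 ^+ k * q.
      rewrite -pB -(@ler_pXn2r _ 2)// ?nnegrE//.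
      rewrite real_normK ?num_real//; apply: le_trans (dq k); exact: pn.
    have [l cl hl] := cvg_geometric_steps q0 pq.
    have -> // : fine (limn_esup (fun k => (p (F k u))%:E)) = l.
      have cE : (fun k => (p (F k u))%:E) @ \oo --> l%:E.
        by apply: cvg_EFin => //; exact: nearW.
      by rewrite (cvg_limn_einf_sup cE).2.
  move=> k; rewrite -(fineK Sfin) -EFinM lee_fin -q2.
  have b1 := part (@complex.Re R) _ _ k; have b2 := part (@complex.Im R) _ _ k.
  have : `|lre u - Re (F k u)| <= 2 * (2^-1 ^+ k * q).
    apply: b1 => [z|[a b] [a' b']//]; by rewrite /nsq lerDl sqr_ge0.
  have : `|lim u - Im (F k u)| <= 2 * (2^-1 ^+ k * q).
    apply: b2 => [z|[a b] [a' b']//]; by rewrite /nsq lerDr sqr_ge0.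
  have -> : nsq (F k u - h u) = `|lre u - Re (F k u)| ^+ 2 + `|lim u - Im (F k u)| ^+ 2.
    by rewrite !real_normK ?num_real// /nsq/=; case: (F k u) => a b /=; ring.
  have -> : 8 * 4^-1 ^+ k * q ^+ 2 = 2 * (2 * (2^-1 ^+ k * q)) ^+ 2.
    rewrite (_ : 4^-1 = 2^-1 ^+ 2 :> R); last by field.
    by rewrite -exprM mulnC exprM; ring.
  have := half0 k; set A := 2^-1 ^+ k * q; set x := `|_|; set y := `|_| => A0 h1 h2.
  have : 0 <= x by exact: normr_ge0.
  have : 0 <= y by exact: normr_ge0.
  by nra.
exists h; split => //.
have le k : (N2 (fun u => (F k u - h u)%R) <= (16 * M * 4^-1 ^+ k)%:E)%E.
  apply: (@le_trans _ _ (\int[mu]_u ((8 * 4^-1 ^+ k)%:E * S u))%E).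
    apply: ae_ge0_le_integral => //.
    - by move=> u _; rewrite lee_fin nsq_ge0.
    - by apply/measurable_EFinP; apply: measurable_nsq; exact: cmeasurableB.
    - by move=> u _; rewrite mule_ge0// lee_fin mulr_ge0// exprn_ge0.
    - exact: emeasurable_funM.
    have iS : mu.-integrable [set: R] S.
      apply/integrableP; split => //.
      under eq_integral do rewrite gee0_abs//.
      by apply: le_lt_trans intS _; exact: ltry.
    have := integrable_ae measurableT iS.
    have FF := ae_filter_ringOfSetsType mu.
    by apply: filterS => u /(_ I) Sfin _; apply: good; rewrite -ge0_fin_numE.
  rewrite ge0_integralZl//.
  apply: (@le_trans _ _ ((8 * 4^-1 ^+ k)%:E * (2 * M)%:E)%E).
    by rewrite lee_wpmul2l// lee_fin mulr_ge0// exprn_ge0.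
  rewrite -EFinM lee_fin le_eqVlt; apply/orP; left; apply/eqP; ring.
apply: (@squeeze_cvge _ _ _ _ (cst 0%E) _ (fun k => (16 * M * 4^-1 ^+ k)%:E)).
- by apply: nearW => k; rewrite N2_ge0 le.
- exact: cvg_cst.
- apply: cvg_EFin; first exact: nearW.
  have := @cvg_geometric R (16 * M) 4^-1 _; apply.
  by rewrite ger0_norm ?invr_ge0//; lra.
Qed.

(** The approximants: bounded support makes a square-integrable function integrable as well. *)
Definition truncate (n : nat) f (x : R) : R[i] := f x * (\1_`[(- n%:R), n%:R] x)%:C.

Let Re_truncate n f x : Re (truncate n f x) = \1_`[(- n%:R), n%:R] x * Re (f x).
Proof. by rewrite /truncate; case: (f x) => a b /=; ring. Qed.

Let Im_truncate n f x : Im (truncate n f x) = \1_`[(- n%:R), n%:R] x * Im (f x).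
Proof. by rewrite /truncate; case: (f x) => a b /=; ring. Qed.

Lemma in_L1_truncate n f : in_L 2 f -> in_L 1 (truncate n f).
Proof.
move=> f2; have [[m1 m2] _] := f2.
have i (k : R -> R) : measurable_fun [set: R] k -> L1 (fun x => k x ^+ 2) ->
    L1 (fun x => \1_`[(- n%:R), n%:R] x * k x).
  move=> mk k2; apply: (@integrable_boundedM_L2 _ _ _ 1 (- n%:R) n%:R) => //.
    by move=> x; rewrite indicE; case: (_ \in _); rewrite ?normr1 ?normr0.
  by move=> x xn; rewrite indicE memNset//= in_itv/=; exact/negP.
apply/in_L1P; split.
  rewrite (_ : (fun x => _) = (fun x => \1_`[(- n%:R), n%:R] x * Re (f x))).
    by apply: i => //; exact: in_L2_Re.
  by apply/funext => x; exact: Re_truncate.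
rewrite (_ : (fun x => _) = (fun x => \1_`[(- n%:R), n%:R] x * Im (f x))).
  by apply: i => //; exact: in_L2_Im.
by apply/funext => x; exact: Im_truncate.
Qed.

Lemma in_L2_truncate n f : in_L 2 f -> in_L 2 (truncate n f).
Proof.
move=> f2; have [mf ff] := (in_L2P f).1 f2; have [mt _] := in_L1_truncate n f2.
apply/in_L2P; split => //; apply: le_lt_trans ff; apply: ge0_le_integral => //.
- by move=> x _; rewrite lee_fin nsq_ge0.
- by apply/measurable_EFinP; exact: measurable_nsq.
- by apply/measurable_EFinP; exact: measurable_nsq.
- move=> x _; rewrite lee_fin /truncate nsqM ler_piMr ?nsq_ge0// /nsq/= indicE.
  by case: (_ \in _); rewrite /= ?expr1n ?expr0n/= ?addr0.
Qed.

Lemma cvg_truncate f : in_L 2 f ->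
  (fun n => N2 (fun x => (truncate n f x - f x)%R)) @ \oo --> 0%E.
Proof.
move=> f2; have [mf ff] := (in_L2P f).1 f2.
have i2 : mu.-integrable [set: R] (fun x => (nsq (f x))%:E).
  apply/integrableP; split; first by apply/measurable_EFinP; exact: measurable_nsq.
  by under eq_integral do rewrite /= ger0_norm ?nsq_ge0//.
have mt n : measurable_fun [set: R] (fun x => (nsq (truncate n f x - f x))%:E).
  apply/measurable_EFinP; apply: measurable_nsq; apply: cmeasurableB => //.
  by have [] := in_L1_truncate n f2.
have := @dominated_cvg _ _ _ mu [set: R] measurableT
  (fun n x => (nsq (truncate n f x - f x))%:E) (cst 0%E) (fun x => (nsq (f x))%:E) mt.
rewrite integral0; apply => //.
- move=> x _; apply: cvg_near_cst; near=> n.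
  rewrite /truncate indicE mem_set ?mulr1 ?subrr.
    by rewrite /nsq/= expr0n/= addr0.
  rewrite /= in_itv/= -ler_norml; near: n; exact: nbhs_infty_ger.
- move=> n x _; rewrite abse_EFin ger0_norm ?nsq_ge0// lee_fin.
  rewrite /truncate indicE; case: (_ \in _) => /=.
    by rewrite mulr1 subrr {1}/nsq/= expr0n/= addr0 nsq_ge0.
  by rewrite mulr0 sub0r nsqN.
Unshelve. all: by end_near. Qed.

(** Truncations are selected with squared error at most [8^-1 ^+ k]. Consecutive ones then differ by
    at most [4 * 8^-1 ^+ k], and [plancherel_N2_le] carries this to the transforms with
    [M = 160 * pi], the rate that [riesz_fischer_N2] asks for. *)
Lemma fourier_L2_exists g : in_L 2 g -> exists h, fourier_L2 g h.
Proof.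
move=> g2; have [mg _] := g2.
have e0 k : 0 < (8^-1 : R) ^+ k by rewrite exprn_gt0// invr_gt0.
have /choice[phi hphi] : forall k : nat, exists n : nat,
    (N2 (fun x => (truncate n g x - g x)%R) <= (8^-1 ^+ k)%:E)%E.
  move=> k; have /fine_cvgP[finN cvgN] := cvg_truncate g2.
  have : \forall n \near \oo, (N2 (fun x => (truncate n g x - g x)%R) <= (8^-1 ^+ k)%:E)%E.
    near=> n.
    have fn : N2 (fun x => (truncate n g x - g x)%R) \is a fin_num by near: n.
    rewrite -(fineK fn) lee_fin ltW//; near: n; exact: (cvgr_lt _ cvgN).
  by move=> [N _ hN]; exists N; apply: hN => /=.
pose f k := truncate (phi k) g.
have f1 k : in_L 1 (f k) by exact: in_L1_truncate.
have f2 k : in_L 2 (f k) by exact: in_L2_truncate.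
have mfg k : cmeasurable (fun x => f k x - g x).
  by apply: cmeasurableB => //; have [] := f1 k.
have M0 : 0 <= 160 * pi :> R by apply: mulr_ge0; [exact: ler0n|exact: pi_ge0].
have K0 : (0 <= (40 * pi : R)%:E)%E.
  by rewrite lee_fin; apply: mulr_ge0; [exact: ler0n|exact: pi_ge0].
have mF k : cmeasurable (fourier_L1 (f k)) by exact: cmeasurable_fourier_L1.
have step k : (N2 (fun u => (fourier_L1 (f k.+1) u - fourier_L1 (f k) u)%R)
    <= (160 * pi * 8^-1 ^+ k)%:E)%E.
  have -> : (fun u => fourier_L1 (f k.+1) u - fourier_L1 (f k) u) =
      fourier_L1 (fun x => f k.+1 x - f k x).
    by apply/funext => u; rewrite fourier_L1B.
  apply: le_trans (plancherel_N2_le (in_L1B (f1 k.+1) (f1 k))) _.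
  have -> : 160 * pi * 8^-1 ^+ k = 40 * pi * (2 * 8^-1 ^+ k + 2 * 8^-1 ^+ k) :> R by ring.
  rewrite [X in (_ <= X)%E]EFinM lee_wpmul2l// EFinD.
  have -> : N2 (fun x => (f k.+1 x - f k x)%R) = N2 (fun x => ((f k.+1 x - g x) - (f k x - g x))%R).
    by apply: eq_integral => x _; congr ((nsq _)%:E); ring.
  apply: le_trans (le_N2B (mfg _) (mfg _)) _; rewrite !EFinM.
  apply: leeD; rewrite lee_wpmul2l ?lee_fin//; last exact: hphi.
  apply: le_trans (hphi k.+1) _; rewrite lee_fin exprS.
  by apply: ler_piMl; [exact: ltW|lra].
have [h [mh hF]] := riesz_fischer_N2 M0 mF step.
exists h; split; last first.
  exists f; split => //; apply/cLnorm2_cvg0 => //.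
  apply: (@squeeze_cvge _ _ _ _ (cst 0%E) _ (fun k => (8^-1 ^+ k)%:E)).
  - by apply: nearW => k; rewrite N2_ge0; exact: hphi.
  - exact: cvg_cst.
  - apply: cvg_EFin; first exact: nearW.
    have := @cvg_expr R 8^-1; apply.
    by rewrite ger0_norm ?invr_ge0//; lra.
apply/in_L2P; split => //.
(* The limit is square-integrable because it is at finite distance from one of the transforms,
   itself square-integrable. *)
have /fine_cvgP[[N _ finN] _] := hF.
have fN : N2 (fun u => (fourier_L1 (f N) u - h u)%R) \is a fin_num by apply: finN => /=.
have -> : N2 h = N2 (fun u => (fourier_L1 (f N) u - (fourier_L1 (f N) u - h u))%R).
  by apply: eq_integral => u _; congr ((nsq _)%:E); ring.
have mFh : cmeasurable (fun u => fourier_L1 (f N) u - h u) by exact: cmeasurableB.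
apply: le_lt_trans (le_N2B (mF N) mFh) _.
apply: lte_add_pinfty; apply: lte_mul_pinfty; rewrite ?lee_fin//; last first.
  by rewrite -ge0_fin_numE// N2_ge0.
apply: le_lt_trans (plancherel_N2_le (f1 N)) _.
by apply: lte_mul_pinfty => //; have [] := (in_L2P _).1 (f2 N).
Unshelve. all: by end_near. Qed.

End existence.

(** The transform is determined only almost everywhere, so integrability is claimed for every
    representative; the existence clause keeps that claim from being vacuous. *)
Theorem lemma2p5 (R : realType) (g : R -> complex R) (hg : in_H1 g) :
  (exists h : R -> complex R, fourier_L2 g h) /\
  (forall h : R -> complex R, fourier_L2 g h -> in_L 1%R h).
Proof.
split; first by apply: fourier_L2_exists; have [] := hg.
by move=> h; exact: fourier_L2_in_L1.
Qed.
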